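(* Let $H$ be an oriented graph on $h$ vertices. Then $H$ is easy if and only if $V(H)$ can be partitioned into $2$ sets, each of which spans an acyclic directed graph in $H$.
   Context: An oriented graph is a directed graph with no loops in which between any two distinct vertices there is at most one edge. An $n$-vertex tournament $T$ is $\varepsilon$-far from being $H$-free if one must change the direction of at least $\varepsilon n^2$ edges of $T$ in order to obtain a tournament containing no copy of $H$ (a copy of $H$ is a subgraph of $T$ isomorphic to $H$, not necessarily induced). Let $f^*_H(\varepsilon)$ denote the largest quantity such that (for all sufficiently large $n$) every $n$-vertex tournament that is $\varepsilon$-far from being $H$-free contains at least $f^*_H(\varepsilon)n^h$ copies of $H$. $H$ is called easy if there is a constant $c=c(H)$ such that $f^*_H(\varepsilon)\ge \varepsilon^c$ for every sufficiently small $\varepsilon>0$; otherwise $H$ is hard. *)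

(* Defs.v *)
From HB Require Import structures.
From mathcomp Require Import all_boot all_order all_algebra.
From mathcomp Require Import all_classical all_reals all_analysis.
Set Implicit Arguments. Unset Strict Implicit. Unset Printing Implicit Defensive.
Import Order.TTheory GRing.Theory Num.Theory.
Local Open Scope ring_scope.

Definition oriented_graph (h : nat) (H : rel 'I_h) : Prop :=
  (forall x, ~~ H x x) /\ (forall x y, H x y -> ~~ H y x).

Definition tournament (n : nat) (T : rel 'I_n) : Prop :=
  (forall x, ~~ T x x) /\ (forall x y, x != y -> T x y != T y x).

Definition embedding (h n : nat) (H : rel 'I_h) (T : rel 'I_n)
  (phi : {ffun 'I_h -> 'I_n}) : bool :=
  injectiveb phi && [forall x, forall y, H x y ==> T (phi x) (phi y)].

Definition copy_of (h n : nat) (H : rel 'I_h) (phi : {ffun 'I_h -> 'I_n})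
  : {set 'I_n} * {set 'I_n * 'I_n} :=
  (phi @: setT, [set (phi e.1, phi e.2) | e in [set e : 'I_h * 'I_h | H e.1 e.2]]).

Definition num_copies (h n : nat) (H : rel 'I_h) (T : rel 'I_n) : nat :=
  #|[set copy_of H phi | phi in [set phi | embedding H T phi]]|.

Definition H_free (h n : nat) (H : rel 'I_h) (T : rel 'I_n) : Prop :=
  num_copies H T = 0%N.

(* Number of edges whose direction differs between tournaments T and T'
   (each unordered pair counted once: the ordering with T x y). *)
Definition tdist (n : nat) (T T' : rel 'I_n) : nat :=
  #|[set p : 'I_n * 'I_n | T p.1 p.2 && ~~ T' p.1 p.2]|.

Definition eps_far (R : realType) (h n : nat) (H : rel 'I_h) (T : rel 'I_n)
  (eps : R) : Prop :=
  forall T' : rel 'I_n, tournament T' -> H_free H T' ->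
    eps * (n%:R ^+ 2) <= (tdist T T')%:R.

Definition admissible (R : realType) (h : nat) (H : rel 'I_h) (eps f : R) : Prop :=
  exists N : nat, forall n : nat, (N <= n)%N ->
    forall T : rel 'I_n, tournament T -> eps_far H T eps ->
      f * (n%:R ^+ h) <= (num_copies H T)%:R.

Definition fstar (R : realType) (h : nat) (H : rel 'I_h) (eps : R) : \bar R :=
  ereal_sup [set (f%:E)%E | f in [set f : R | admissible H eps f]].

Definition easy (R : realType) (h : nat) (H : rel 'I_h) : Prop :=
  exists c : R, exists eps0 : R, 0 < eps0 /\
    forall eps : R, 0 < eps -> eps < eps0 -> ((eps `^ c)%:E <= fstar H eps)%E.

Definition acyclic_on (h : nat) (H : rel 'I_h) (A : {set 'I_h}) : Prop :=
  forall c : seq 'I_h, c != [::] -> uniq c -> all (fun x => x \in A) c ->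
    ~~ cycle H c.

(* Main.v *)
(* Let H = A + B with A and B acyclic, and let T be far from H-free.  If a random sample of
   poly(1/eps) vertices has out-neighbourhoods that fail to approximate most of the others, then
   the sample contains poly(1/eps) vertices with pairwise very different out-neighbourhoods; by
   Sauer-Shelah they shatter a large set inside a second random sample, and transitive
   subtournaments of the shattered set and of suitable rows realise A, B and every pattern
   between them, so T has many copies of H.  Otherwise the sample induces a partition of T into
   poly(1/eps) clusters; for random representatives x_j, orienting the pairs between two
   clusters as their representatives, and the pairs inside a cluster by the vertex order, changes
   few edges, so the new tournament contains H.  Its copies give a positive poly(eps) density of
   one configuration of representatives, hence (power means) of its blow-ups with parts of size
   2^h, and the acyclic part of H in each cluster is found in a transitive subtournament.

   Conversely, assume that H has no such partition.  For every linear order of V(H) the graph of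
   backward edges has odd cycles.  Among the graphs containing a backedge graph, let B be minimal
   for the existence of homomorphisms, r an endomorphism of B of minimal image and C a cycle in
   r(B).  Part i of the host tournament consists of the points of a grid; for a point x and a
   vector a of a sphere the points x + c_i a span a copy of H, the pairs of these copies in
   B-adjacent parts being the only ones that do not follow a fixed order.  By the minimality of B
   every copy of H contains a cycle of such pairs lying over C; if the slopes c_i increase along C,
   convexity of the sphere makes its points collinear, so copies of H are rare, although the host
   contains many copies of H with pairwise disjoint sets of pairs. *)
Require Import Defs.
From HB Require Import structures.
From mathcomp Require Import all_boot all_order all_algebra.
From mathcomp Require Import all_classical all_reals all_analysis.
(* Imported again so that the names of [finset] shadow those of [classical_sets]. *)
From mathcomp Require Import all_boot all_order all_algebra zify ring.
Set Implicit Arguments. Unset Strict Implicit. Unset Printing Implicit Defensive.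
Import Order.TTheory GRing.Theory Num.Theory.

(** * Counting functions on finite types *)

Definition upd (I : finType) (V : Type) (z : {ffun I -> V}) (i : I) (v : V) :=
  [ffun j => if j == i then v else z j].

Lemma upd_id (I : finType) (V : Type) (z : {ffun I -> V}) i : upd z i (z i) = z.
Proof. by apply/ffunP => j; rewrite ffunE; case: eqP => [->|]. Qed.

Lemma upd_eq (I : finType) (V : Type) (z : {ffun I -> V}) i v : upd z i v i = v.
Proof. by rewrite ffunE eqxx. Qed.

Lemma upd_neq (I : finType) (V : Type) (z : {ffun I -> V}) i j v :
  j != i -> upd z i v j = z j.
Proof. by rewrite ffunE => /negbTE ->. Qed.

Lemma upd_upd (I : finType) (V : Type) (z : {ffun I -> V}) i v w :
  upd (upd z i v) i w = upd z i w.
Proof. by apply/ffunP => j; rewrite !ffunE; case: eqP. Qed.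

Lemma upd_family (I V : finType) (F : I -> {set V}) (z : {ffun I -> V}) i v :
  z \in family F -> v \in F i -> upd z i v \in family F.
Proof.
move=> /familyP zF vF; apply/familyP => j; rewrite ffunE.
by case: eqP => [->|_] //; apply: zF.
Qed.

(** Exchanging [z i] with [v] is an involution of the pairs [(z, v)]. This is how a random
    coordinate is replaced by a fresh independent one. *)
Lemma resample_family (I V : finType) (F : I -> {set V}) (i : I)
    (Phi : {ffun I -> V} -> V -> nat) :
  \sum_(z in family F) \sum_(v in F i) Phi (upd z i v) (z i) =
  \sum_(z in family F) \sum_(v in F i) Phi z v.
Proof.
rewrite !pair_big /=.
pose g (p : {ffun I -> V} * V) := (upd p.1 i p.2, p.1 i).
have gK : involutive g.
  by case=> z v; rewrite /g /= upd_upd upd_id upd_eq.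
rewrite [RHS](reindex_inj (inv_inj gK)) /=.
apply: eq_bigl => -[z v] /=; apply/andP/andP => -[zF vF]; split.
- exact: upd_family.
- by move/familyP: zF.
- have /familyP zF' := zF.
  have := upd_family zF vF; rewrite upd_upd upd_id //.
- by have /familyP/(_ i) := zF; rewrite upd_eq.
Qed.

Lemma resample (I V : finType) (i : I) (Phi : {ffun I -> V} -> nat) :
  \sum_z \sum_v Phi (upd z i v) = #|V| * \sum_z Phi z.
Proof.
have := resample_family (fun _ => [set: V]) i (fun z _ => Phi z).
have E (f : {ffun I -> V} -> nat) :
    \sum_(z in family (fun=> [set: V])) f z = \sum_z f z.
  by apply: eq_bigl => z; apply/familyP => j; rewrite inE.
rewrite !E; under eq_bigr do under eq_bigl do rewrite inE.
move=> ->; rewrite big_distrr /=; apply: eq_bigr => z _.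
by rewrite sum_nat_const cardsT.
Qed.

Definition overwrite (A I : finType) (V : Type) (al : A -> I)
    (z : {ffun I -> V}) (psi : {ffun A -> V}) :=
  [ffun i => if [pick a | al a == i] is Some a then psi a else z i].

(** The exchange of one coordinate with a fresh value, done at all coordinates in the image of [al]
    at once. Counting through this bijection replaces arguments with product measures. *)
Definition swap_along (A I : finType) (V : Type) (al : A -> I)
    (p : {ffun I -> V} * {ffun A -> V}) :=
  (overwrite al p.1 p.2, [ffun a => p.1 (al a)]).

Section SwapAlong.
Variables (A I : finType) (V : Type) (al : A -> I).
Hypothesis al_inj : injective al.

Lemma overwriteE (z : {ffun I -> V}) psi a : overwrite al z psi (al a) = psi a.
Proof.
rewrite ffunE; case: pickP => [b /eqP /al_inj -> //|/(_ a)].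
by rewrite eqxx.
Qed.

Lemma overwrite_out (z : {ffun I -> V}) psi i :
  (forall a, al a != i) -> overwrite al z psi i = z i.
Proof. by move=> h; rewrite ffunE; case: pickP => // a; rewrite (negbTE (h a)). Qed.

Lemma swap_alongK : involutive (@swap_along A I V al).
Proof.
case=> z psi; rewrite /swap_along /=; congr pair; apply/ffunP.
  move=> i; rewrite ffunE; case: pickP => [a /eqP <-|h]; first by rewrite ffunE.
  by rewrite overwrite_out // => a; rewrite h.
by move=> a; rewrite ffunE overwriteE.
Qed.

End SwapAlong.

Lemma card_along (A I V : finType) (al : A -> I) (F : {set {ffun A -> V}}) :
  injective al ->
  #|[set z : {ffun I -> V} | [ffun a => z (al a)] \in F]| * #|V| ^ #|A|
  = #|F| * #|V| ^ #|I|.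
Proof.
move=> al_inj.
have cT (J : finType) : #|[set: {ffun J -> V}]| = #|V| ^ #|J|.
  by rewrite cardsT (card_ffun J V).
set Z := [set z | _].
have g_inj : injective (@swap_along A I V al) by apply/inv_inj/swap_alongK.
have : #|setX Z [set: {ffun A -> V}]| = #|setX [set: {ffun I -> V}] F|.
  rewrite -[RHS](card_preimset _ g_inj); apply: eq_card => -[z psi].
  by rewrite !inE andbT.
by rewrite !cardsX !cT [X in _ = X -> _]mulnC.
Qed.

Lemma card_bigcup_le (I T : finType) (F : I -> {set T}) :
  #|\bigcup_i F i| <= \sum_i #|F i|.
Proof.
elim/big_ind2: _ => [|m X n Y mX nY|//]; first by rewrite cards0.
by apply: leq_trans (leq_add mX nY); rewrite cardsU leq_subr.
Qed.

(** A union bound over the maps [al]: for each of them, [card_along] gives the restricted samples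
    the density of [F]. It turns a share of good samples into a share of good configurations. *)
Lemma sample_bound (B I V : finType) (F : {set {ffun B -> V}})
    (Z : {set {ffun I -> V}}) :
  (forall z, z \in Z ->
     exists2 al : B -> I, injective al & [ffun a => z (al a)] \in F) ->
  #|Z| * #|V| ^ #|B| <= #|I| ^ #|B| * (#|F| * #|V| ^ #|I|).
Proof.
move=> ZF.
pose Za (al : {ffun B -> I}) :=
  [set z : {ffun I -> V} | injectiveb al && ([ffun a => z (al a)] \in F)].
have sZ : Z \subset \bigcup_al Za al.
  apply/subsetP => z /ZF[al al_inj zF].
  apply/bigcupP; exists (finfun al) => //; rewrite inE; apply/andP; split.
    by apply/injectiveP => a b; rewrite !ffunE => /al_inj.
  by rewrite (_ : [ffun a => _] = [ffun a => z (al a)]) //; apply/ffunP => a; rewrite !ffunE.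
have leZ : #|Z| <= \sum_al #|Za al|.
  exact: leq_trans (subset_leq_card sZ) (card_bigcup_le _).
apply: leq_trans (leq_mul leZ (leqnn _)) _.
rewrite big_distrl /=.
apply: leq_trans (_ : \sum_(al : {ffun B -> I}) (#|F| * #|V| ^ #|I|) <= _); last first.
  by rewrite sum_nat_const card_ffun.
apply: leq_sum => al _.
have [al_inj|nal] := boolP (injectiveb al).
  rewrite -(card_along F (injectiveP _ al_inj)).
  rewrite leq_mul2r; apply/orP; right; apply: subset_leq_card.
  by apply/subsetP => z; rewrite !inE => /andP[].
rewrite (_ : Za al = set0) ?cards0 ?mul0n //.
by apply/setP => z; rewrite !inE (negbTE nal).
Qed.

(** When [z i] equals [z j], overwriting coordinate [i] loses no information. *)
Lemma card_coincide (I V : finType) (i j : I) : i != j ->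
  #|[set z : {ffun I -> V} | z i == z j]| * #|V| <= #|V| ^ #|I|.
Proof.
move=> ij; set Z := [set z | _].
pose g (p : {ffun I -> V} * V) := upd p.1 i p.2.
have g_inj : {in setX Z setT &, injective g}.
  case=> [z v] [z' v']; rewrite !inE !andbT /g /= => /eqP zij /eqP zij' E.
  have Ek k : k != i -> z k = z' k.
    by move=> ki; have /ffunP/(_ k) := E; rewrite !upd_neq.
  congr pair; last by have /ffunP/(_ i) := E; rewrite !upd_eq.
  apply/ffunP => k; have [->|ki] := eqVneq k i; last exact: Ek.
  by rewrite zij zij'; apply: Ek; rewrite eq_sym.
rewrite -[X in _ * X]cardsT -cardsX -(card_in_imset g_inj).
by apply: leq_trans (max_card _) _; rewrite card_ffun.
Qed.

Lemma card_noninjective (I V : finType) :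
  #|[set z : {ffun I -> V} | ~~ injectiveb z]| * #|V|
  <= #|I| ^ 2 * #|V| ^ #|I|.
Proof.
pose Zp (p : I * I) := [set z : {ffun I -> V} | (p.1 != p.2) && (z p.1 == z p.2)].
have sZ : [set z : {ffun I -> V} | ~~ injectiveb z] \subset \bigcup_p Zp p.
  apply/subsetP => z; rewrite inE => /injectivePn[a [b ab zab]].
  by apply/bigcupP; exists (a, b) => //; rewrite inE ab /= zab.
have leZ : #|[set z : {ffun I -> V} | ~~ injectiveb z]| <= \sum_p #|Zp p|.
  exact: leq_trans (subset_leq_card sZ) (card_bigcup_le _).
apply: leq_trans (leq_mul leZ (leqnn _)) _.
rewrite big_distrl /= -mulnn -card_prod -sum_nat_const.
apply: leq_sum => -[a b] _.
have [->|ab] := eqVneq a b.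
  rewrite (_ : Zp _ = set0) ?cards0 //.
  by apply/setP => z; rewrite !inE /= eqxx.
apply: leq_trans (card_coincide V ab).
rewrite leq_mul2r; apply/orP; right; apply: subset_leq_card.
by apply/subsetP => z; rewrite !inE => /andP[].
Qed.

(** Expanded form of [(b - a) * (b ^ k - a ^ k) >= 0]. *)
Lemma chebyshev_step (a b k : nat) : a * b ^ k + b * a ^ k <= a ^ k.+1 + b ^ k.+1.
Proof.
wlog ab : a b / a <= b.
  move=> H; have [/H //|/ltnW/H] := leqP a b.
  by rewrite addnC [X in _ <= X]addnC.
have abk : a ^ k <= b ^ k by case: k => // k; rewrite leq_exp2r.
rewrite !expnS; nia.
Qed.

Lemma power_mean (I : finType) (a : I -> nat) (k : nat) :
  (\sum_i a i) ^ k.+1 <= #|I| ^ k * \sum_i a i ^ k.+1.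
Proof.
elim: k => [|k IHk]; first by rewrite mul1n expn1.
rewrite expnS; apply: leq_trans (leq_mul (leqnn _) IHk) _.
rewrite mulnCA [in leqRHS]expnS -mulnA [in leqRHS]mulnCA leq_mul2l; apply/orP; right.
(* Doubling makes the double sum symmetric in [i] and [j], so that [chebyshev_step] applies to each
   pair. *)
rewrite -(leq_pmul2l (ltn0Sn 1)) mul2n -addnn.
rewrite {1}big_distrl [X in _ + X]mulnC [X in _ + X]big_distrl /=.
have E1 : \sum_i a i * (\sum_i a i ^ k.+1) = \sum_i \sum_j a i * a j ^ k.+1.
  by apply: eq_bigr => i _; rewrite big_distrr.
have E2 : \sum_i a i ^ k.+1 * (\sum_i a i) = \sum_i \sum_j a j * a i ^ k.+1.
  by apply: eq_bigr => i _; rewrite big_distrr; apply: eq_bigr => j _; rewrite mulnC.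
rewrite E1 E2 -big_split /=; under eq_bigr do rewrite -big_split /=.
apply: (leq_trans (n := \sum_i \sum_j (a i ^ k.+2 + a j ^ k.+2))).
  by apply: leq_sum => i _; apply: leq_sum => j _; exact: chebyshev_step.
under eq_bigr do rewrite big_split sum_nat_const /=.
by rewrite big_split sum_nat_const /= -big_distrr /= mul2n addnn.
Qed.

(** * Shattered sets and transitive subtournaments *)

Definition shatters (T : finType) (F : {set {set T}}) (U : {set T}) :=
  [forall P : {set T}, (P \subset U) ==> [exists X in F, X :&: U == P]].

(* Pajor's form of the Sauer-Shelah lemma. *)
Lemma card_shattered (T : finType) (F : {set {set T}}) (D : {set T}) :
  (forall X, X \in F -> X \subset D) ->
  #|F| <= #|[set U : {set T} | (U \subset D) && shatters F U]|.
Proof.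
elim: {D}#|D| {-2}D (erefl #|D|) F => [|m IHm] D cD F FD.
  have FS : F \subset [set set0].
    apply/subsetP => X /FD; rewrite inE; move/eqP: cD; rewrite cards_eq0 => /eqP ->.
    by rewrite subset0.
  have [->|/set0Pn[X XF]] := eqVneq F set0; first by rewrite cards0.
  have X0 : X = set0 by apply/eqP; move/subsetP: FS => /(_ X XF); rewrite inE.
  apply: subset_leq_card; apply: subset_trans FS _; rewrite sub1set inE sub0set /=.
  apply/forallP => P; apply/implyP; rewrite subset0 => /eqP ->.
  by apply/existsP; exists X; rewrite XF setI0 eqxx.
have [x xD] : exists x, x \in D by apply/set0Pn; rewrite -card_gt0 cD.
(* The sets avoiding [x] and the traces of those containing [x] are treated by induction. A set [U]
   shattered by both families counts twice: as [U] and as [x |: U]. *)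
pose F0 := [set X in F | x \notin X].
pose F1 := [set X :\ x | X in [set X in F | x \in X]].
have cD' : #|D :\ x| = m by move: cD; rewrite (cardsD1 x) xD => -[].
have F0D X : X \in F0 -> X \subset D :\ x.
  by rewrite inE => /andP[/FD XD xX]; rewrite subsetD1 XD.
have F1D X : X \in F1 -> X \subset D :\ x.
  by move=> /imsetP[Y]; rewrite inE => /andP[/FD YD xY] ->; rewrite setSD.
have cF : #|F| = #|F0| + #|F1|.
  rewrite card_in_imset; last first.
    move=> X Y; rewrite !inE => /andP[_ xX] /andP[_ xY] E.
    by rewrite -(setD1K xX) -(setD1K xY) E.
  rewrite -(cardsID [set X : {set T} | x \in X] F) addnC; congr (_ + _).
    by apply: eq_card => X; rewrite !inE andbC.
  by apply: eq_card => X; rewrite !inE.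
have := leq_add (IHm _ cD' _ F0D) (IHm _ cD' _ F1D); rewrite -cF => le.
apply: leq_trans le _.
set S0 := [set U | _]; set S1 := [set U | _]; set S := [set U | _].
have -> : #|S0| + #|S1| = #|S0 :|: S1| + #|S0 :&: S1| by rewrite cardsUI.
have xS U : U \in S0 :|: S1 -> x \notin U.
  by rewrite !inE !subsetD1 => /orP[] /andP[/andP[]].
have inj : {in S0 :&: S1 &, injective (fun U => x |: U)}.
  move=> U V US VS E.
  have xU : x \notin U by apply: xS; move: US; rewrite !inE => /andP[-> _].
  have xV : x \notin V by apply: xS; move: VS; rewrite !inE => /andP[-> _].
  by rewrite -(setU1K xU) -(setU1K xV) E.
rewrite -(card_in_imset inj) -cardsUI.
rewrite (_ : _ :&: [set _ | _ in _] = set0) ?cards0 ?addn0; last first.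
  apply/setP => U; rewrite [RHS]inE; apply/negP; rewrite inE => /andP[/xS xU].
  by case/imsetP => V _ E; rewrite E setU11 in xU.
apply: subset_leq_card; apply/subsetP => U; rewrite inE => /orP[US|].
  have xU := xS _ US; rewrite inE; move: US; rewrite !inE.
  case/orP => /andP[]; rewrite subsetD1 => /andP[-> _] /forallP sh /=; apply/forallP => P;
    apply/implyP => PU; move: (sh P); rewrite PU => /existsP[X /andP[XF /eqP XP]].
    by apply/existsP; exists X; move: XF; rewrite inE => /andP[-> _]; rewrite XP eqxx.
  move: XF => /imsetP[Y]; rewrite inE => /andP[YF xY] EX.
  apply/existsP; exists Y; rewrite YF -XP EX /= ; apply/eqP/setP => z; rewrite !inE.
  by case: eqVneq => [->|//]; rewrite (negbTE xU) !andbF.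
case/imsetP => V VS ->.
have xV : x \notin V by apply: xS; move: VS; rewrite !inE => /andP[-> _].
move: VS; rewrite !inE => /andP[/andP[VD /forallP sh0] /andP[_ /forallP sh1]].
apply/andP; split; first by rewrite subUset sub1set xD (subset_trans VD) ?subsetDl.
apply/forallP => P; apply/implyP => PU.
have PV : P :\ x \subset V by rewrite subDset.
have [xP|xP] := boolP (x \in P).
  move: (sh1 (P :\ x)); rewrite PV => /existsP[X /andP[/imsetP[Y]]].
  rewrite inE => /andP[YF xY] -> /eqP E.
  apply/existsP; exists Y; rewrite YF /=; apply/eqP/setP => z.
  have /setP/(_ z) := E; rewrite !inE; case: eqVneq => [->|//].
  by rewrite xY xP.
move: (sh0 (P :\ x)); rewrite PV => /existsP[X /andP[]].
rewrite inE => /andP[XF xX] /eqP E.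
apply/existsP; exists X; rewrite XF /=; apply/eqP/setP => z.
have /setP/(_ z) := E; rewrite !inE; case: eqVneq => [->|//].
by rewrite (negbTE xX) (negbTE xP).
Qed.

(** A set with at most [k] elements is read off from a map of ['I_k] to [option T], so there are at
    most [#|T|.+1 ^ k] such sets, too few for the shattered sets of [card_shattered]. *)
Lemma sauer_shelah (T : finType) (F : {set {set T}}) (k : nat) :
  #|T|.+1 ^ k < #|F| -> exists2 U : {set T}, shatters F U & k < #|U|.
Proof.
move=> kF; apply/exists_inP; apply: contraLR kF; rewrite negb_exists -leqNgt => /forallP small.
apply: leq_trans (card_shattered (D := setT) _) _ => [X _|]; first exact: subsetT.
rewrite -[#|T|.+1]card_option -[k]card_ord -card_ffun.
pose im (f : {ffun 'I_k -> option T}) := [set x | Some x \in codom f].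
apply: leq_trans (_ : #|im @: setT| <= _); last first.
  by apply: leq_trans (leq_imset_card _ _) _; rewrite cardsT.
apply: subset_leq_card; apply/subsetP => U; rewrite inE subsetT /= => shU.
move: (small U); rewrite shU /= -leqNgt => Uk.
apply/imsetP; exists [ffun i : 'I_k => nth None [seq Some x | x <- enum U] i] => //.
apply/setP => x; rewrite inE; apply/idP/codomP => [xU|[i]].
  have iU : index x (enum U) < k by apply: leq_trans Uk; rewrite cardE index_mem mem_enum.
  exists (Ordinal iU); rewrite ffunE /= (nth_map x) ?nth_index ?index_mem ?mem_enum //.
rewrite ffunE => E.
have [iU|iU] := ltnP i (size (enum U)).
  by move: E; rewrite (nth_map x) // => -[->]; rewrite -mem_enum mem_nth.
by move: E; rewrite nth_default ?size_map.
Qed.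

(** Among the other elements of [X], the out-neighbours of [x] or the rest number at least half;
    recursion enters a side with at least [2 ^ k] elements and [x] is put first or last
    accordingly. *)
Lemma transitive_list (T : finType) (e : rel T) (k : nat) (X : {set T}) :
  (forall x y, x != y -> e x y || e y x) -> 2 ^ k <= #|X| ->
  exists2 l : seq T, size l = k & uniq l && pairwise e l && all (mem X) l.
Proof.
move=> tot; elim: k X => [|k IHk] X cX; first by exists [::].
have /set0Pn[x xX] : X != set0 by rewrite -card_gt0 (leq_trans _ cX) ?expn_gt0.
pose Y := [set y in X :\ x | e x y]; pose Z := (X :\ x) :\: Y.
have cYZ : #|X| = (#|Y| + #|Z|).+1.
  rewrite (cardsD1 x) xX add1n; congr _.+1.
  rewrite -(cardsID Y (X :\ x)); congr (_ + _); apply: eq_card => y.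
  by rewrite !inE; case: (y != x); case: (y \in X); case: (e x y).
have [cY|cY] := leqP (2 ^ k) #|Y|.
  have [l sl /andP[/andP[ul pl] /allP al]] := IHk _ cY.
  exists (x :: l); rewrite /= ?sl // ul pl xX /= andbT.
  apply/andP; split; [apply/and3P; split=> //|].
  - by apply/negP => /al /=; rewrite !inE eqxx.
  - by apply/allP => y /al /=; rewrite !inE => /andP[].
  - by apply/allP => y /al /=; rewrite !inE => /andP[/andP[]].
have cZ : 2 ^ k <= #|Z| by move: cX; rewrite cYZ expnS; lia.
have [l sl /andP[/andP[ul pl] /allP al]] := IHk _ cZ.
exists (rcons l x); rewrite ?size_rcons ?sl // rcons_uniq pairwise_rcons all_rcons ul pl /=.
rewrite xX andbT /=; apply/andP; split; [apply/andP; split|].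
- by apply/negP => /al /=; rewrite !inE eqxx.
- rewrite andbT; apply/allP => y /al /=; rewrite !inE => /andP[+ /andP[yx yX]].
  by rewrite yx yX /= => nxy; have := tot _ _ yx; rewrite (negbTE nxy) orbF.
- by apply/allP => y /al /=; rewrite !inE => /andP[_ /andP[]].
Qed.

(** * Blow-ups of dense configurations *)

Section BoxBlowUp.
Variables (I V : finType) (M : nat) (E : {set {ffun I -> V}}).
Hypothesis V_gt0 : 0 < #|V|.
Local Notation Omega := {ffun I * 'I_M.+1 -> V}.

(** Only the coordinates in [D] may use all [M.+1] copies. From [set0] to the full set, this
    interpolates between one configuration in [E] and a complete blow-up. *)
Definition blown_up (D : {set I}) : {set Omega} :=
  [set w : Omega | [forall k : {ffun I -> 'I_M.+1},
    [forall a, (a \in D) || (k a == ord0)] ==> ([ffun a => w (a, k a)] \in E)]].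

(** With [N w] the number of values that may be put at [(a, ord0)], the power mean inequality bounds
    below the number of ways to choose [M.+1] such values independently; writing them into the
    copies of [a] gives a point of [blown_up (a |: D)]. *)
Lemma blown_upS (D : {set I}) (a : I) : a \notin D ->
  #|blown_up D| ^ M.+1 <= #|{: Omega}| ^ M * #|blown_up (a |: D)|.
Proof.
move=> aD; set ED := blown_up D.
pose N (w : Omega) := #|[set v | upd w (a, ord0) v \in ED]|.
have sumN : \sum_w N w = #|V| * #|ED|.
  transitivity (#|V| * \sum_w nat_of_bool (w \in ED)); last by rewrite -[#|ED|]sum1_card [in RHS]big_mkcond.
  rewrite -(resample (a, ord0)); apply: eq_bigr => w _.
  by rewrite /N -sum1_card big_mkcond; apply: eq_bigr => v _; rewrite inE.
have sumNM : \sum_w N w ^ M.+1 <= #|blown_up (a |: D)| * #|V| ^ M.+1.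
  pose W := [set p : Omega * {ffun 'I_M.+1 -> V} | [forall m, upd p.1 (a, ord0) (p.2 m) \in ED]].
  have -> : \sum_w N w ^ M.+1 = #|W|.
    rewrite -sum1_card (partition_big fst predT) //=; apply: eq_bigr => w _.
    transitivity #|pair w @: [set psi : {ffun 'I_M.+1 -> V} | [forall m, upd w (a, ord0) (psi m) \in ED]]|.
      rewrite card_imset => [|psi psi' [] //].
      transitivity (N w ^ #|'I_M.+1|); first by rewrite card_ord.
      rewrite -card_ffun_on; apply: eq_card => psi.
      rewrite !inE; apply/ffun_onP/forallP => H m; have := H m; rewrite inE //.
    rewrite -sum1_card; apply: eq_bigl => -[w' psi]; rewrite !inE /=.
    apply/imsetP/andP => [[psi']|[H /eqP <-]].
      by rewrite inE => H [-> ->].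
    by exists psi; rewrite // inE.
  have al_inj : injective (pair a : 'I_M.+1 -> I * 'I_M.+1) by move=> m m' [].
  have g_inj : injective (@swap_along _ _ V (pair a : 'I_M.+1 -> I * 'I_M.+1)).
    by apply/inv_inj/swap_alongK.
  have -> : #|V| ^ M.+1 = #|[set: {ffun 'I_M.+1 -> V}]|.
    by rewrite cardsT card_ffun card_ord.
  rewrite -(card_imset _ g_inj) -cardsX.
  apply: subset_leq_card; apply/subsetP => _ /imsetP[[w psi] + ->].
  rewrite !inE andbT /= => /forallP wED.
  apply/forallP => k; apply/implyP => /forallP k0.
  have := wED (k a); rewrite inE => /forallP/(_ (upd k a ord0))/implyP.
  rewrite (_ : [ffun b => overwrite _ _ _ _] =
               [ffun b => upd w (a, ord0) (psi (k a)) (b, upd k a ord0 b)]).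
    apply; apply/forallP => b; rewrite ffunE; have [->|ba] := eqVneq b a; first by rewrite eqxx orbT.
    by have := k0 b; rewrite !inE (negbTE ba).
  apply/ffunP => b; rewrite ffunE [RHS]ffunE; have [->|ba] := eqVneq b a.
    by rewrite overwriteE // upd_eq upd_eq.
  rewrite (upd_neq _ _ ba) upd_neq; last by apply: contraNneq ba => -[->].
  by rewrite overwrite_out // => m; apply: contraNneq ba => -[->].
have := power_mean N M; rewrite sumN expnMn => H.
have := leq_trans H (leq_mul (leqnn _) sumNM).
rewrite mulnA [leqRHS]mulnC leq_pmul2l // expn_gt0 V_gt0 //.
Qed.

(** Each coordinate of [I] raises the density [1 / P] to the power [M.+1], whence the iterated
    exponent. *)
Lemma blow_up_bound (P : nat) :
  #|V| ^ #|I| <= P * #|E| ->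
  #|V| ^ (#|I| * M.+1) <= P ^ (M.+1 ^ #|I|) *
    #|[set w : Omega | [forall k : {ffun I -> 'I_M.+1}, [ffun a => w (a, k a)] \in E]]|.
Proof.
move=> PE.
have cO : #|{: Omega}| = #|V| ^ (#|I| * M.+1) by rewrite card_ffun card_prod card_ord.
have base : #|{: Omega}| <= P * #|blown_up set0|.
  have al_inj : injective (fun a : I => (a, ord0 : 'I_M.+1)) by move=> a b [].
  have := card_along E al_inj.
  have -> : [set z : Omega | [ffun a => z (a, ord0)] \in E] = blown_up set0.
    apply/setP => z; rewrite !inE; apply/idP/forallP => [zE k|H].
      apply/implyP => /forallP k0.
      rewrite (_ : [ffun a => _] = [ffun a => z (a, ord0)]) //.
      by apply/ffunP => a; rewrite !ffunE; have := k0 a; rewrite inE /= => /eqP ->.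
    have /implyP := H [ffun=> ord0].
    rewrite (_ : [ffun a => z (a, _)] = [ffun a => z (a, ord0)]).
      by apply; apply/forallP => a; rewrite ffunE eqxx orbT.
    by apply/ffunP => a; rewrite !ffunE.
  rewrite -(card_ffun (I * 'I_M.+1)%type V) => along.
  have x_gt0 : 0 < #|V| ^ #|I| by rewrite expn_gt0 V_gt0.
  rewrite -(leq_pmul2l x_gt0) mulnCA [_ ^ _ * #|blown_up _|]mulnC along mulnA.
  by rewrite leq_mul2r PE orbT.
have step m : m <= #|I| -> exists2 D : {set I}, #|D| = m &
    #|{: Omega}| <= P ^ (M.+1 ^ m) * #|blown_up D|.
  elim: m => [|m IHm] mI; first by exists set0; rewrite ?cards0 ?expn1.
  have [D cD le] := IHm (ltnW mI).
  have /set0Pn[a] : ~: D != set0.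
    by rewrite -card_gt0; have := cardsC D; lia.
  rewrite inE => aD; exists (a |: D); first by rewrite cardsU1 aD cD.
  have Omega_gt0 : 0 < #|{: Omega}| ^ M by rewrite expn_gt0 cO expn_gt0 V_gt0.
  rewrite -(leq_pmul2l Omega_gt0) -expnSr.
  apply: leq_trans (_ : (P ^ (M.+1 ^ m) * #|blown_up D|) ^ M.+1 <= _).
    by rewrite leq_exp2r.
  rewrite expnMn -expnM -expnSr mulnCA leq_mul2l; apply/orP; right.
  exact: blown_upS.
have [D cD] := step _ (leqnn _); rewrite cO => le.
apply: leq_trans le _; rewrite leq_mul2l; apply/orP; right; apply: subset_leq_card.
apply/subsetP => w; rewrite !inE => /forallP H; apply/forallP => k.
have DT : D = setT by apply/eqP; rewrite eqEcard subsetT cardsT cD leqnn.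
by apply: (implyP (H k)); apply/forallP => a; rewrite DT inE.
Qed.

End BoxBlowUp.

(** * Homomorphisms into tournaments *)

(** The part [A] goes to columns in [J], the rest to rows in [I]. The columns form a transitive list
    of [h] blocks in which every pattern on [2 ^ h] rows occurs once per block. Hence the rows can
    be made transitive first, and each vertex of [A] then finds, in the block given by its rank, a
    column with the right pattern. *)
Lemma embed_shattered (h : nat) (H : rel 'I_h) (A : {set 'I_h})
    (kappa : 'I_h -> 'I_h) (I J : finType) (e : rel (I + J)) (R : {set I}) (U : {set J}) :
  0 < h -> (forall x y, H x y -> ~~ H y x) -> injective kappa ->
  (forall x y, H x y -> (x \in A) = (y \in A) -> kappa x < kappa y) ->
  (forall x y, x != y -> e x y = ~~ e y x) ->
  shatters [set [set k | e (inl i) (inr k)] | i in R] U ->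
  2 ^ (h * #|{set 'I_(2 ^ h)}|) <= #|U| ->
  exists2 al : 'I_h -> I + J,
    injective al & forall x y, H x y -> e (al x) (al y).
Proof.
move=> h_gt0 Hanti kinj kmono etour /forallP sh cU.
set M := 2 ^ h in cU; set G := #|{set 'I_M}| in cU.
have G_gt0 : 0 < G by apply/card_gt0P; exists set0.
have tot (x y : J) : x != y -> e (inr x) (inr y) || e (inr y) (inr x).
  by move=> xy; rewrite etour ?orNb //; apply: contraNneq xy => -[->].
have [l sl /andP[/andP[ul pl] /allP al]] :=
  transitive_list (e := fun x y => e (inr x) (inr y)) tot cU.
have j0 : J by case: l sl {ul pl al} => // /esym/eqP; rewrite muln_eq0; lia.
pose u p := nth j0 l p.
have uU p : p < h * G -> u p \in U by move=> lt; apply: al; rewrite mem_nth ?sl.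
pose gset p := nth set0 (enum {set 'I_M}) (p %% G).
(* Shattering provides a row [rho k] that points to the column at position [p] exactly when [k]
   belongs to the pattern assigned to [p]. *)
have /fin_all_exists[rho rhoE] (k : 'I_M) : exists i : I,
    forall p, p < h * G -> e (inl i) (inr (u p)) = (k \in gset p).
  pose P := [set j in U | (j \in l) && (k \in gset (index j l))].
  have PU : P \subset U by apply/subsetP => j; rewrite inE => /andP[].
  have := sh P; rewrite PU => /existsP[X /andP[/imsetP[i iR ->] /eqP XP]].
  exists i => p lt; have /setP/(_ (u p)) := XP; rewrite !inE uU // andbT => ->.
  by rewrite /= mem_nth ?sl // index_uniq ?sl.
pose pos (i : nat) (g : {set 'I_M}) := i * G + index g (enum {set 'I_M}).
have idx (g : {set 'I_M}) : index g (enum {set 'I_M}) < G.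
  by rewrite /G [#|_|]cardE index_mem mem_enum.
have pos_lt i g : i < h -> pos i g < h * G.
  by move=> lt; rewrite /pos; have := idx g; nia.
have gsetE i g : gset (pos i g) = g.
  by rewrite /gset /pos modnMDl modn_small // nth_index // mem_enum.
have rho_inj : injective rho.
  move=> k k' E; have := rhoE k _ (pos_lt 0 [set k] h_gt0).
  by rewrite E rhoE ?pos_lt // gsetE !inE eqxx => /eqP.
have totr (x y : 'I_M) : x != y ->
    e (inl (rho x)) (inl (rho y)) || e (inl (rho y)) (inl (rho x)).
  by move=> xy; rewrite etour ?orNb //; apply: contraNneq xy => -[/rho_inj ->].
have cM : 2 ^ h <= #|[set: 'I_M]| by rewrite cardsT card_ord.
have [lr slr /andP[/andP[ulr plr] _]] :=
  transitive_list (e := fun x y => e (inl (rho x)) (inl (rho y))) totr cM.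
have k0 : 'I_M by apply: (Ordinal (n := M) (m := 0)); rewrite expn_gt0.
pose kr (x : 'I_h) := nth k0 lr (kappa x).
have kr_inj : injective kr.
  move=> x y /eqP; rewrite nth_uniq ?slr // => /eqP E.
  by apply/kinj/val_inj.
(* The pattern required of the column of [x]: the rows of its in-neighbours outside [A]. *)
pose g (x : 'I_h) := [set kr y | y in [set y | (y \notin A) && H y x]].
pose px (x : 'I_h) := pos (kappa x) (g x).
have px_lt x : px x < h * G by apply: pos_lt.
have px_mono x y : kappa x < kappa y -> px x < px y.
  by move=> lt; rewrite /px /pos; have := idx (g x); nia.
exists (fun x => if x \in A then inr (u (px x)) else inl (rho (kr x))) => [x y|x y Hxy].
  case: ifP => xA; case: ifP => yA // [].
    move=> /eqP; rewrite nth_uniq ?sl // => /eqP E; apply/kinj/val_inj/eqP.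
    by case: ltngtP => // /px_mono; rewrite E ltnn.
  by move=> /rho_inj/kr_inj.
case: ifP => xA; case: ifP => yA.
- apply: (pairwiseP j0 pl); rewrite ?inE ?sl //; apply: px_mono.
  by apply: kmono => //; rewrite xA yA.
- rewrite etour // rhoE // gsetE; apply/imsetP => -[z]; rewrite inE => /andP[_ Hzx].
  by move=> /kr_inj E; move: (Hanti _ _ Hxy); rewrite E Hzx.
- by rewrite rhoE // gsetE; apply/imsetP; exists x; rewrite // inE xA.
- apply: (pairwiseP k0 plr); rewrite ?inE ?slr //.
  by apply: kmono => //; rewrite xA yA.
Qed.

Definition homs (h : nat) (H : rel 'I_h) (V : finType) (T : rel V) :=
  [set phi : {ffun 'I_h -> V} | [forall x, forall y, H x y ==> T (phi x) (phi y)]].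

(** The maps that are not injective have density at most [#|I| ^ 2 / #|V|], which is at most half of
    [1 / Q] for large [V]. *)
Lemma card_injective_part (I V : finType) (Z : {set {ffun I -> V}}) (Q : nat) :
  0 < #|V| -> #|V| ^ #|I| <= Q * #|Z| -> 2 * Q * #|I| ^ 2 <= #|V| ->
  #|V| ^ #|I| <= 2 * Q * #|[set z in Z | injectiveb z]|.
Proof.
move=> V_gt0 QZ Vbig; set Zi := [set z in Z | _].
have le : #|Z| <= #|Zi| + #|[set z : {ffun I -> V} | ~~ injectiveb z]|.
  rewrite -(cardsID [set z : {ffun I -> V} | injectiveb z] Z) leq_add //.
    by apply: subset_leq_card; apply/subsetP => z; rewrite !inE.
  by apply: subset_leq_card; apply/subsetP => z; rewrite !inE => /andP[].
have := card_noninjective I V.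
set nI := #|[set z : {ffun I -> V} | ~~ injectiveb z]| in le *; set x := _ ^ #|I| in QZ *; move: le QZ Vbig V_gt0.
set n := #|V|; set m := #|I| ^ 2; set zi := #|Zi|; set z := #|Z| => le QZ Vbig V_gt0 nIn.
rewrite -(leq_pmul2l V_gt0).
have h1 : 2 * (n * x) <= n * (2 * Q * zi) + 2 * Q * (nI * n).
  apply: leq_trans (_ : 2 * (n * (Q * (zi + nI))) <= _); last by nia.
  by rewrite !leq_mul2l (leq_trans QZ) ?orbT // leq_mul2l le orbT.
have h2 : 2 * Q * (nI * n) <= n * x.
  apply: leq_trans (_ : 2 * Q * (m * x) <= _); first by rewrite leq_mul2l nIn orbT.
  by rewrite mulnA leq_mul2r Vbig orbT.
lia.
Qed.

Lemma sample_homs (h : nat) (H : rel 'I_h) (V I : finType) (T : rel V)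
    (Z : {set {ffun I -> V}}) (Q : nat) :
  0 < #|V| -> #|V| ^ #|I| <= Q * #|Z| -> 2 * Q * #|I| ^ 2 <= #|V| ->
  (forall z, z \in Z -> injective z -> exists2 al : 'I_h -> I,
     injective al & forall x y, H x y -> T (z (al x)) (z (al y))) ->
  #|V| ^ h <= 2 * Q * #|I| ^ h * #|homs H T|.
Proof.
move=> V_gt0 QZ Vbig Zhom.
have QZi := card_injective_part V_gt0 QZ Vbig.
set Zi := [set z in Z | _] in QZi.
have : #|Zi| * #|V| ^ #|'I_h| <= #|I| ^ #|'I_h| * (#|homs H T| * #|V| ^ #|I|).
  apply: sample_bound => z; rewrite inE => /andP[zZ /injectiveP z_inj].
  have [al al_inj alH] := Zhom z zZ z_inj; exists al => //.
  rewrite inE; apply/forallP => x; apply/forallP => y; apply/implyP => Hxy.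
  by rewrite !ffunE alH.
rewrite card_ord => le.
have x_gt0 : 0 < #|V| ^ #|I| by rewrite expn_gt0 V_gt0.
rewrite -(leq_pmul2l x_gt0).
apply: leq_trans (leq_mul QZi (leqnn _)) _.
rewrite -mulnA; apply: leq_trans (leq_mul (leqnn _) le) _.
by rewrite -!mulnA [X in _ <= X]mulnC -!mulnA.
Qed.

(** The configurations of representatives are blown up to parts of size [2 ^ h]. Each part contains
    a transitive list of length [h], and the vertex [a] takes the place [kappa a] in the list of its
    part. *)
Lemma homs_of_clusters (h : nat) (H : rel 'I_h) (V D : finType) (T : rel V)
    (gam : 'I_h -> D) (kappa : 'I_h -> 'I_h) (P : nat) :
  0 < #|V| -> (forall x y, x != y -> T x y || T y x) ->
  injective kappa -> (forall a b, H a b -> gam a = gam b -> kappa a < kappa b) ->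
  #|D| <= h -> 0 < P ->
  #|V| ^ #|D| <= P * #|[set z : {ffun D -> V} | [forall a, forall b,
     H a b && (gam a != gam b) ==> T (z (gam a)) (z (gam b))]]| ->
  2 * P ^ ((2 ^ h) ^ h) * (h * 2 ^ h) ^ 2 <= #|V| ->
  #|V| ^ h <= 2 * P ^ ((2 ^ h) ^ h) * (h * 2 ^ h) ^ h * #|homs H T|.
Proof.
move=> V_gt0 tot kinj kmono cD P_gt0 PE Vbig.
set E := [set z | _] in PE.
have M_gt0 : 0 < 2 ^ h by rewrite expn_gt0.
have ME := prednK M_gt0; set M' := (2 ^ h).-1 in ME.
have := blow_up_bound M' V_gt0 PE.
set W := [set w | _] => QW.
set Q := P ^ _ in Vbig *.
have cI : #|{: D * 'I_M'.+1}| = #|D| * M'.+1 by rewrite card_prod card_ord.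
have cI' : #|D| * M'.+1 <= h * 2 ^ h by rewrite ME leq_mul2r cD orbT.
have le2 : 2 * Q * #|{: D * 'I_M'.+1}| ^ 2 <= #|V|.
  by apply: leq_trans Vbig; rewrite leq_mul2l cI leq_exp2r // cI' orbT.
have le1 : #|V| ^ #|{: D * 'I_M'.+1}| <= Q * #|W|.
  rewrite cI (leq_trans QW) // leq_mul2r; apply/orP; right.
  by rewrite ME leq_pexp2l // leq_pexp2l.
apply: (leq_trans (sample_homs (H := H) (T := T) V_gt0 le1 le2 _)); last first.
  rewrite leq_mul2r; apply/orP; right; rewrite leq_mul2l; apply/orP; right.
  by case: {+}h cI' => // h'; rewrite cI leq_exp2r.
move=> w; rewrite inE => /forallP wE w_inj.
have /fin_all_exists2[l sl lP] (d : D) : exists2 l : seq 'I_M'.+1, size l = h &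
    uniq l && pairwise (fun i j => T (w (d, i)) (w (d, j))) l.
  have [i j ij| |l sl /andP[lP _]] := transitive_list
    (e := fun i j => T (w (d, i)) (w (d, j))) (k := h) (X := [set: 'I_M'.+1]).
  - by apply: tot; apply: contraNneq ij => /w_inj[->].
  - by rewrite cardsT card_ord ME.
  - by exists l.
pose mu (a : 'I_h) := nth ord0 (l (gam a)) (kappa a).
exists (fun a => (gam a, mu a)) => [a b [gab]|a b Hab].
  rewrite /mu gab => /eqP; have /andP[ul _] := lP (gam b).
  by rewrite nth_uniq ?sl // => /eqP/val_inj/kinj.
have [gab|gab] := eqVneq (gam a) (gam b).
  have /andP[_ pl] := lP (gam b).
  rewrite /mu gab; apply: (pairwiseP ord0 pl); rewrite ?inE ?sl //.
  exact: kmono.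
(* This choice function takes the value [mu a] at the part of [a] and [mu b] at every other part, in
   particular at that of [b]. *)
have := wE (upd [ffun=> mu b] (gam a) (mu a)); rewrite inE.
move=> /forallP/(_ a)/forallP/(_ b); rewrite Hab gab /= !ffunE eqxx.
by rewrite eq_sym (negbTE gab).
Qed.

(** * Samples that leave many vertices uncovered *)

Section Coverage.
Variables (V : finType) (T : rel V) (e : nat).

Definition disagreement (u v : V) := #|[set w | T u w != T v w]|.
Definition far (u v : V) := #|V| < e * disagreement u v.

(** Each of the [t] independent points misses the disagreement set with probability less than
    [1 - 1 / e]. *)
Lemma card_agreement (u v : V) (t : nat) : far u v ->
  e ^ t * #|[set w : {ffun 'I_t -> V} | [forall k, T u (w k) == T v (w k)]]|
  <= e.-1 ^ t * #|V| ^ t.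
Proof.
rewrite /far /disagreement => uv.
set D := [set w | _] in uv.
have -> : #|[set w : {ffun 'I_t -> V} | [forall k, T u (w k) == T v (w k)]]| = #|~: D| ^ t.
  rewrite -[in RHS](card_ord t) -card_ffun_on; apply: eq_card => w.
  rewrite inE; apply/forallP/ffun_onP => H k; have := H k; rewrite !inE ?negbK //.
case: t => // t; rewrite -!expnMn leq_exp2r //.
by have := cardsC D; nia.
Qed.

Variable s : nat.
Hypothesis uncovered : forall y : {ffun 'I_s -> V},
  #|V| <= e * #|[set u | [forall i, far (y i) u]]|.

(* Two records are far from each other, and uncovered points keep creating new ones. *)
Definition records (z : {ffun 'I_s -> V}) :=
  [set i : 'I_s | [forall j : 'I_s, (j < i) ==> far (z j) (z i)]].

(** A resampled coordinate is far from all the others, hence a record, with probability at least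
    [1 / e]. So the mean number of records is at least [s / e], and a share [1 / (2 * e)] of the
    samples reaches half of this. *)
Lemma card_many_records : 0 < s -> 0 < #|V| ->
  #|V| ^ s <= 2 * e * #|[set z | s <= 2 * e * #|records z|]|.
Proof.
move=> s_gt0 V_gt0; set Big := [set z | _]; set n := #|V|.
have sumR : s * n ^ s <= e * \sum_z #|records z|.
  have -> : \sum_z #|records z| = \sum_(i < s) \sum_z nat_of_bool (i \in records z).
    by rewrite exchange_big; apply: eq_bigr => z _; rewrite -sum1_card big_mkcond.
  rewrite -[X in X * n ^ s]card_ord -sum_nat_const big_distrr /=.
  apply: leq_sum => i _; rewrite -(leq_pmul2l V_gt0).
  rewrite mulnCA -(resample i) big_distrr /=.
  rewrite -[X in _ ^ X](card_ord s) -card_ffun mulnC -sum_nat_const.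
  apply: leq_sum => z _; apply: leq_trans (uncovered z) _; rewrite leq_mul2l.
  apply/orP; right; rewrite -sum1_card big_mkcond; apply: leq_sum => v _ /=.
  case: ifP => //; rewrite inE => /forallP fz.
  rewrite lt0b inE; apply/forallP => j; apply/implyP => ji.
  by rewrite upd_eq upd_neq ?fz // -val_eqE neq_ltn ji.
have split_sum : 2 * e * \sum_z #|records z| <= 2 * e * s * #|Big| + s * n ^ s.
  have -> : 2 * e * s * #|Big| = \sum_z (if z \in Big then 2 * e * s else 0).
    by rewrite -big_mkcond sum_nat_const mulnC.
  have -> : s * n ^ s = \sum_(z : {ffun 'I_s -> V}) s.
    by rewrite sum_nat_const card_ffun card_ord mulnC.
  rewrite big_distrr -big_split; apply: leq_sum => z _ /=; rewrite inE.
  case: (leqP s) => [_|/ltnW //]. apply: leq_trans _ (leq_addr _ _).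
  by rewrite leq_mul2l -[X in _ <= X](card_ord s) max_card orbT.
nia.
Qed.

Hypothesis T_total : forall x y, x != y -> T x y = ~~ T y x.

Variables (h : nat) (H : rel 'I_h) (A : {set 'I_h}) (kappa : 'I_h -> 'I_h).
Hypotheses (h_gt0 : 0 < h) (Hanti : forall x y, H x y -> ~~ H y x).
Hypotheses (kinj : injective kappa)
  (kmono : forall x y, H x y -> (x \in A) = (y \in A) -> kappa x < kappa y).

(** A second sample of [t] points separates all pairs of records with probability at least one half.
    The more than [t.+1 ^ k] records then have distinct traces on it, Sauer-Shelah gives a shattered
    set with more than [k] elements, and [embed_shattered] finds a copy of [H] in the joint
    sample. *)
Lemma many_homs_of_uncovered (t : nat) :
  let k := 2 ^ (h * #|{set 'I_(2 ^ h)}|) in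
  0 < e -> 0 < #|V| -> 2 * e * t.+1 ^ k < s -> 2 * s ^ 2 * e.-1 ^ t <= e ^ t ->
  8 * e * (s + t) ^ 2 <= #|V| ->
  #|V| ^ h <= 8 * e * (s + t) ^ h * #|homs H T|.
Proof.
move=> k e_gt0 V_gt0 s_big t_big V_big; set n := #|V| in V_big *.
have cBig := card_many_records (leq_ltn_trans (leq0n _) s_big) V_gt0.
set Big := [set z | _] in cBig.
pose W (z : {ffun 'I_s -> V}) := [set w : {ffun 'I_t -> V} |
  [forall i in records z, forall j in records z,
     (i != j) ==> [exists l, T (z i) (w l) != T (z j) (w l)]]].
have far_records z i j : i \in records z -> j \in records z -> i != j ->
    far (z i) (z j) || far (z j) (z i).
  rewrite !inE => /forallP iR /forallP jR; rewrite -val_eqE neq_ltn => /orP[ij|ji].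
    by rewrite (implyP (jR i) ij).
  by rewrite (implyP (iR j) ji) orbT.
have cW z : n ^ t <= 2 * #|W z|.
  pose B (p : 'I_s * 'I_s) := [set w : {ffun 'I_t -> V} |
    [&& p.1 \in records z, p.2 \in records z, p.1 != p.2 &
        [forall l, T (z p.1) (w l) == T (z p.2) (w l)]]].
  have WB : ~: W z \subset \bigcup_p B p.
    apply/subsetP => w; rewrite in_setC inE => /forall_inPn[i iR /forall_inPn[j jR]].
    rewrite negb_imply => /andP[ij /existsPn agree].
    apply/bigcupP; exists (i, j) => //; rewrite inE iR jR ij /=.
    by apply/forallP => l; have := agree l; rewrite negbK.
  have cB p : e ^ t * #|B p| <= e.-1 ^ t * n ^ t.
    have [/and3P[iR jR ij]|npR] :=
      boolP [&& p.1 \in records z, p.2 \in records z & p.1 != p.2].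
      have /orP[fij|fji] := far_records _ _ _ iR jR ij.
        apply: leq_trans (card_agreement t fij); rewrite leq_mul2l; apply/orP; right.
        by apply: subset_leq_card; apply/subsetP => w wB; rewrite inE; move: wB; rewrite inE => /and4P[].
      apply: leq_trans (card_agreement t fji); rewrite leq_mul2l; apply/orP; right.
      apply: subset_leq_card; apply/subsetP => w wB; rewrite inE; move: wB; rewrite inE => /and4P[_ _ _ /forallP agree].
      by apply/forallP => l; rewrite eq_sym.
    rewrite (_ : B p = set0) ?cards0 ?muln0 //; apply/setP => w; rewrite inE [RHS]inE.
    by apply: contraNF npR => /and4P[-> -> ->].
  have cWC : e ^ t * #|~: W z| <= s ^ 2 * (e.-1 ^ t * n ^ t).
    apply: leq_trans (leq_mul (leqnn _) (leq_trans (subset_leq_card WB) (card_bigcup_le _))) _.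
    rewrite big_distrr /=.
    apply: (@leq_trans (\sum_(p : 'I_s * 'I_s) e.-1 ^ t * n ^ t)).
      by apply: leq_sum => p _; exact: cB.
    by rewrite sum_nat_const card_prod card_ord.
  have cT : #|W z| + #|~: W z| = n ^ t by rewrite cardsC card_ffun card_ord.
  have et_gt0 : 0 < e ^ t by rewrite expn_gt0 e_gt0.
  suff : 2 * #|~: W z| <= n ^ t by lia.
  rewrite -(leq_pmul2l et_gt0) mulnCA (leq_trans (leq_mul (leqnn 2) cWC)) //.
  by rewrite mulnA mulnA leq_mul2r t_big orbT.
pose Z := [set q : {ffun 'I_s + 'I_t -> V} |
  ([ffun i => q (inl i)] \in Big) && ([ffun l => q (inr l)] \in W [ffun i => q (inl i)])].
(* A share [1 / (2 * e)] for the first sample, times one half for the second. *)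
have cZ : n ^ #|{: 'I_s + 'I_t}| <= 4 * e * #|Z|.
  rewrite card_sum !card_ord expnD.
  apply: leq_trans (_ : 2 * e * #|Big| * n ^ t <= _); first by rewrite leq_mul2r cBig orbT.
  suff : #|Big| * n ^ t <= 2 * #|Z| by nia.
  rewrite -sum_nat_const.
  apply: (@leq_trans (\sum_(z in Big) 2 * #|W z|)); first by apply: leq_sum.
  rewrite -big_distrr leq_mul2l /=.
  pose P := [set p : {ffun 'I_s -> V} * {ffun 'I_t -> V} | (p.1 \in Big) && (p.2 \in W p.1)].
  have -> : \sum_(z in Big) #|W z| = #|P|.
    rewrite -[RHS]sum1_card (eq_bigl (fun p => (p.1 \in Big) && (p.2 \in W p.1))).
      rewrite -(pair_big_dep (fun z => z \in Big) (fun z w => w \in W z) (fun _ _ => 1)) /=.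
      by apply: eq_bigr => z _; rewrite sum1_card.
    by move=> p; rewrite !inE.
  pose glue (p : {ffun 'I_s -> V} * {ffun 'I_t -> V}) : {ffun 'I_s + 'I_t -> V} :=
    [ffun x => match x with inl i => p.1 i | inr l => p.2 l end].
  have glue1 p : [ffun i => glue p (inl i)] = p.1 by apply/ffunP => i; rewrite !ffunE.
  have glue2 p : [ffun i => glue p (inr i)] = p.2 by apply/ffunP => i; rewrite !ffunE.
  have glue_inj : injective glue.
    move=> p q pq; rewrite [p]surjective_pairing [q]surjective_pairing.
    by rewrite -(glue1 p) -(glue1 q) -(glue2 p) -(glue2 q) pq.
  rewrite -(card_imset _ glue_inj) subset_leq_card //.
  apply/subsetP => _ /imsetP[p + ->]; rewrite [_ \in Z]inE glue1 glue2.
  by rewrite inE.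
have V_big' : 2 * (4 * e) * #|{: 'I_s + 'I_t}| ^ 2 <= #|V|.
  by rewrite card_sum !card_ord mulnA.
have := sample_homs (H := H) (T := T) V_gt0 cZ V_big'; rewrite card_sum !card_ord mulnA; apply.
move=> q; rewrite inE => /andP[]; set z := [ffun i => q (inl i)]; set w := [ffun l => _].
rewrite inE => zBig; rewrite inE => /forall_inP wW q_inj.
pose F := [set [set l | T (z i) (w l)] | i in records z].
have cF : #|F| = #|records z|.
  apply: card_in_imset => i j iR jR ij; apply/eqP; apply: contraT => nij.
  have /forall_inP/(_ j jR) := wW i iR; rewrite nij => /existsP[l].
  by have /setP/(_ l) := ij; rewrite !inE => ->; rewrite eqxx.
have [|U shU cU] := @sauer_shelah _ F k.
  rewrite cF card_ord; nia.
have [|||al al_inj alH] := @embed_shattered h H A kappa _ _ (fun x y => T (q x) (q y)) (records z) U h_gt0 Hanti kinj kmono.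
- by move=> x y xy; apply: T_total; apply: contraNneq xy => /q_inj ->.
- congr (shatters _ _): shU; apply: eq_imset => i; apply/setP => l.
  by rewrite !inE !ffunE.
- exact: ltnW.
by exists al.
Qed.

End Coverage.

(** * Clusters and representatives *)

Lemma lex_key_inj (h : nat) (f : 'I_h -> nat) : injective (fun x : 'I_h => f x * h + x).
Proof. by move=> x y /(congr1 (modn^~ h)); rewrite !modnMDl !modn_small // => /val_inj. Qed.

(** Ties of [f] are broken by the index; the rank is the number of smaller elements. *)
Lemma rank_of_key (h : nat) (f : 'I_h -> nat) :
  exists2 kappa : 'I_h -> 'I_h, injective kappa &
    forall a b, f a < f b -> kappa a < kappa b.
Proof.
pose g (x : 'I_h) := f x * h + x; pose S a := [set b | g b < g a].
have S_lt a : #|S a| < h.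
  rewrite -[X in _ < X]card_ord -cardsT; apply: proper_card.
  by apply/properP; split; [exact: subsetT|exists a; rewrite ?inE ?ltnn].
have mono a b : g a < g b -> #|S a| < #|S b|.
  move=> ab; apply: proper_card; apply/properP; split.
    by apply/subsetP => x; rewrite !inE => /ltn_trans; apply.
  by exists a; rewrite !inE ?ltnn.
exists (fun a => Ordinal (S_lt a)) => [a b /(congr1 val) /= E|a b fab].
  by apply: (@lex_key_inj h f); case: (ltngtP (g a) (g b)) => // /mono; rewrite E ltnn.
by apply: mono; rewrite /g; have := ltn_ord a; nia.
Qed.

Lemma ex_large_term (I : finType) (F : I -> nat) (c : nat) :
  0 < c -> c <= \sum_i F i -> exists i, c <= #|I| * F i.
Proof.
move=> c_gt0 cF; apply/existsP; apply: contraLR cF; rewrite negb_exists -ltnNge => /forallP small.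
have [I0|I_gt0] := posnP #|I|.
  by rewrite big1 // => i; have := fintype0 i I0.
rewrite -(ltn_pmul2l I_gt0) big_distrr /=.
apply: (@leq_ltn_trans (\sum_(i : I) c.-1)).
  by apply: leq_sum => i _; have := small i; rewrite -ltnNge => lt; rewrite -ltnS prednK.
by rewrite sum_nat_const ltn_pmul2l // prednK.
Qed.

Section Disagreement.
Variables (V : finType) (T : rel V).

Lemma disagreementC u v : disagreement T u v = disagreement T v u.
Proof. by apply: eq_card => w; rewrite !inE eq_sym. Qed.

Lemma disagreement_triangle u v w :
  disagreement T u w <= disagreement T u v + disagreement T v w.
Proof.
apply: leq_trans (_ : #|[set z | T u z != T v z] :|: [set z | T v z != T w z]| <= _).
  apply: subset_leq_card; apply/subsetP => z; rewrite !inE.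
  by case: (T u z); case: (T v z); case: (T w z).
by rewrite cardsU leq_subr.
Qed.

(** Reversing edges turns columns into rows except at [z = u] and [z = v], which account for the
    2. *)
Lemma card_column_disagreement u v :
  (forall x y, x != y -> T x y = ~~ T y x) ->
  #|[set z | T z u != T z v]| <= disagreement T u v + 2.
Proof.
move=> tot; apply: leq_trans (_ : #|[set z | T u z != T v z] :|: [set u; v]| <= _).
  apply: subset_leq_card; apply/subsetP => z; rewrite !inE.
  have [->|zu] := eqVneq z u; first by rewrite orbT.
  have [->|zv] := eqVneq z v; first by rewrite !orbT.
  by rewrite (tot z u) // (tot z v) // orbF; case: (T u z); case: (T v z).
apply: leq_trans (_ : #|[set z | T u z != T v z]| + #|[set u; v]| <= _).
  by rewrite cardsU leq_subr.
by rewrite leq_add2l cards2; case: (_ != _).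
Qed.

End Disagreement.

Lemma card_residue_class (n e : nat) (u : 'I_n) : 0 < e ->
  e * #|[set w : 'I_n | w %% e == u %% e]| <= n + e.
Proof.
move=> e_gt0.
pose m := (n %/ e).+1.
have le : #|[set w : 'I_n | w %% e == u %% e]| <= m.
  pose q (w : 'I_n) : 'I_m := inord (w %/ e).
  have q_inj : {in [set w : 'I_n | w %% e == u %% e] &, injective q}.
    move=> w w'; rewrite !inE => /eqP wE /eqP wE' /(congr1 val).
    have lt (z : 'I_n) : z %/ e < m by rewrite ltnS leq_div2r // ltnW.
    rewrite /q /= !inordK // => E; apply: val_inj.
    by rewrite /= (divn_eq w e) (divn_eq w' e) E wE wE'.
  by rewrite -(card_in_imset q_inj) (leq_trans (max_card _)) ?card_ord.
apply: leq_trans (leq_mul (leqnn e) le) _.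
by rewrite mulnS addnC leq_add2r mulnC leq_trunc_div.
Qed.

Section Clusters.
Variables (n e s : nat) (T : rel 'I_n) (y : {ffun 'I_s -> 'I_n}).
Hypothesis T_total : forall u w, u != w -> T u w = ~~ T w u.
Hypotheses (e_gt2 : 2 < e) (n_big : 2 * e <= n).
Hypothesis covered : e * #|[set u | [forall i, far T e (y i) u]]| <= n.

Let e_gt0 : 0 < e := ltnW (ltnW e_gt2).
Let n_gt0 : 0 < n. Proof. by apply: leq_trans n_big; rewrite muln_gt0 e_gt0. Qed.
Local Notation J := ('I_s * 'I_e)%type.

(** The residue modulo [e] cuts the clusters down to about [n / e] vertices each, which makes it
    cheap to reorient the pairs inside a cluster. *)
Definition precluster (u : 'I_n) : option J :=
  if [pick i | ~~ far T e (y i) u] is Some i then Some (i, Ordinal (ltn_pmod u e_gt0))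
  else None.

Definition members (j : J) := [set u | precluster u == Some j].
(** With this threshold the [s * e] possible clusters lose at most [n / e] vertices through those
    that are not big. *)
Definition big_cluster (j : J) := n <= s * e ^ 2 * #|members j|.
Definition stray := [set u | if precluster u is Some j then ~~ big_cluster j else true].

Lemma card_stray : e * #|stray| <= 2 * n.
Proof.
pose small := \bigcup_j (if big_cluster j then set0 else members j).
have cS : e * #|small| <= n.
  have [s0|s_gt0] := posnP s.
    rewrite (_ : small = set0) ?cards0 ?muln0 //; apply/setP => u; rewrite inE.
    by apply/bigcupP => -[[[i i_lt] _] _ _]; rewrite s0 in i_lt.
  have se_gt0 : 0 < s * e by rewrite muln_gt0 s_gt0.
  rewrite -(leq_pmul2l se_gt0).
  apply: leq_trans (leq_mul (leqnn _) (leq_mul (leqnn e) (card_bigcup_le _))) _.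
  rewrite mulnA big_distrr /=.
  apply: (@leq_trans (\sum_(j : J) n)).
    apply: leq_sum => j _; rewrite -[s * e * e]mulnA mulnn.
    by rewrite /big_cluster; case: (leqP n) => [_|/ltnW //]; rewrite cards0 muln0.
  by rewrite sum_nat_const card_prod !card_ord.
have sub : stray \subset [set u | [forall i, far T e (y i) u]] :|: small.
  apply/subsetP => u; rewrite inE in_setU.
  case E : (precluster u) => [j|] H.
    apply/orP; right; apply/bigcupP; exists j => //.
    by rewrite (negbTE H) inE E.
  apply/orP; left; rewrite inE; apply/forallP => i; move: E; rewrite /precluster.
  by case: pickP => // /(_ i) /negbFE.
have := subset_leq_card sub; rewrite cardsU => le.
have := leq_mul (leqnn e) le; lia.
Qed.

Lemma ex_big_cluster : exists j, big_cluster j.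
Proof.
have [u us] : exists u, u \notin stray.
  apply/existsP; apply: contraT; rewrite negb_exists => /forallP all_stray.
  have sT : stray = setT.
    by apply/setP => u; rewrite [RHS]inE; apply: negbNE; exact: all_stray.
  have := card_stray; rewrite sT cardsT card_ord leq_pmul2r // => e2.
  by rewrite leqNgt e_gt2 in e2.
move: us; rewrite inE; case: (precluster u) => [j|//] /negbNE jb; by exists j.
Qed.

(** Stray vertices are sent to one fixed big cluster, so that every vertex has a cluster with a
    representative. *)
Definition cluster (u : 'I_n) : J :=
  let j0 := xchoose ex_big_cluster in
  if precluster u is Some j then if big_cluster j then j else j0 else j0.

Lemma big_clusterP u : big_cluster (cluster u).
Proof.
rewrite /cluster; case: (precluster u) => [j|]; last exact: xchooseP.
by case: ifP => // _; exact: xchooseP.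
Qed.

Lemma precluster_nonstray u : u \notin stray -> precluster u = Some (cluster u).
Proof. by rewrite inE /cluster; case: (precluster u) => // j /negbNE ->. Qed.

(** An index that is not big carries an arbitrary vertex; the representatives thus form a product
    over all of [J]. *)
Definition cluster_reps : J -> {set 'I_n} :=
  fun j => if big_cluster j then members j else setT.

Lemma precluster_rep x j : x \in family cluster_reps -> big_cluster j ->
  precluster (x j) = Some j.
Proof.
by move=> /familyP/(_ j) + jb; rewrite /cluster_reps jb inE => /eqP.
Qed.

Definition induced (x : {ffun J -> 'I_n}) : rel 'I_n :=
  fun u w => if cluster u == cluster w then u < w else T (x (cluster u)) (x (cluster w)).

Lemma induced_total x u w : x \in family cluster_reps -> u != w ->
  induced x u w != induced x w u.
Proof.
move=> xF uw; rewrite /induced [cluster w == _]eq_sym; case: (eqVneq (cluster u)) => [_|cuw].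
  by move: uw; rewrite -val_eqE; case: ltngtP.
rewrite T_total; first by case: (T _ _).
apply: contraNneq cuw => E; apply/eqP.
have := precluster_rep xF (big_clusterP u).
by rewrite E (precluster_rep xF (big_clusterP w)) => -[].
Qed.

Lemma precluster_disagreement u v j :
  precluster u = Some j -> precluster v = Some j ->
  e * disagreement T u v <= 2 * n.
Proof.
rewrite /precluster; case: pickP => // i ui [<-]; case: pickP => // i' vi' [Ei _].
rewrite {}Ei in vi'.
have := leq_mul (leqnn e) (disagreement_triangle T u (y i) v).
move: ui vi'; rewrite /far card_ord -!leqNgt (disagreementC T (y i) u); lia.
Qed.

Lemma precluster_mod u i k : precluster u = Some (i, k) -> u %% e = k.
Proof. by rewrite /precluster; case: pickP => // i' _ [_ <-]. Qed.

(** Exchanging the representative of the cluster of [u] with [u] itself replaces the row of the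
    representative by the row of [u], without changing the average over [x]. For fixed [w] the error
    then counts the disagreements between the columns of [w] and of its representative, at most
    [2 * n / e + 2]. *)
Lemma sum_rep_error :
  e * \sum_(x in family cluster_reps) \sum_(u | u \notin stray)
    \sum_(w | (w \notin stray) && (cluster u != cluster w))
       (T (x (cluster u)) w != T (x (cluster u)) (x (cluster w)))
  <= #|family cluster_reps| * (3 * n ^ 2).
Proof.
pose Phi j (x : {ffun J -> 'I_n}) v : nat :=
  \sum_(w | (w \notin stray) && (j != cluster w)) (T v w != T v (x (cluster w))).
have stepE x : x \in family cluster_reps ->
  \sum_(u | u \notin stray) \sum_(w | (w \notin stray) && (cluster u != cluster w))
       (T (x (cluster u)) w != T (x (cluster u)) (x (cluster w)) : nat)
  = \sum_(j | big_cluster j) \sum_(v in cluster_reps j) Phi j (upd x j v) (x j).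
  move=> xF; rewrite (partition_big cluster big_cluster) => [|u _]; last exact: big_clusterP.
  apply: eq_bigr => j jb; rewrite /cluster_reps jb; apply: eq_big => [u|u].
    rewrite [in RHS]inE; apply/andP/eqP => [[us /eqP <-]|E]; first exact: precluster_nonstray.
    have us : u \notin stray by rewrite inE E jb.
    by split=> //; have := precluster_nonstray us; rewrite E => -[<-].
  move=> /andP[us /eqP cu]; rewrite /Phi cu; apply: eq_bigr => w /andP[_ jw].
  by rewrite upd_neq // eq_sym.
rewrite (eq_bigr _ stepE) exchange_big /=.
under eq_bigr => j _ do rewrite resample_family.
rewrite exchange_big big_distrr -sum_nat_const /=; apply: leq_sum => x xF.
apply: (@leq_trans (e * \sum_(w | w \notin stray) #|[set v | T v w != T v (x (cluster w))]|)).
  rewrite leq_mul2l; apply/orP; right.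
  apply: (@leq_trans (\sum_(v | v \notin stray) \sum_(w | w \notin stray)
                       (T v w != T v (x (cluster w))))).
    rewrite [leqRHS](partition_big cluster big_cluster) => [|u _]; last exact: big_clusterP.
    apply: leq_sum => j jb; rewrite /cluster_reps jb.
    rewrite [leqRHS](eq_bigl (fun v => v \in members j)).
      apply: leq_sum => v _; rewrite /Phi [leqRHS]big_mkcond [leqLHS]big_mkcond.
      by apply: leq_sum => w _ /=; case: (w \in stray); case: (j != _).
    move=> u; rewrite [RHS]inE; apply/andP/eqP => [[us /eqP <-]|E].
      exact: precluster_nonstray.
    have us : u \notin stray by rewrite inE E jb.
    by split=> //; have := precluster_nonstray us; rewrite E => -[<-].
  rewrite exchange_big; apply: leq_sum => w _ /=.
  rewrite -sum1_card [leqRHS]big_mkcond [leqLHS]big_mkcond; apply: leq_sum => v _ /=.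
  by case: ifP => // _; rewrite inE; case: (_ != _).
rewrite big_distrr /=; apply: (@leq_trans (\sum_(w : 'I_n) 3 * n)); last first.
  by rewrite sum_nat_const card_ord mulnCA mulnn.
rewrite big_mkcond; apply: leq_sum => w _; case: ifP => // ws.
have := card_column_disagreement w (x (cluster w)) T_total => /(leq_mul (leqnn e)) le.
apply: leq_trans le _; rewrite mulnDr.
have := precluster_disagreement (precluster_nonstray ws) (precluster_rep xF (big_clusterP w)).
by set a := e * _; move: n_big; clear; lia.
Qed.

Definition difference (T' : rel 'I_n) := [set p : 'I_n * 'I_n | T p.1 p.2 && ~~ T' p.1 p.2].

(** The constant 11 is 3 from [sum_rep_error] plus 2 for each of four sources: stray [u], stray [w],
    pairs in one residue class, and pairs where the row of [u] differs from that of its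
    representative. *)
Lemma sum_difference :
  e * \sum_(x in family cluster_reps) #|difference (induced x)|
  <= #|family cluster_reps| * (11 * n ^ 2).
Proof.
pose err (x : {ffun J -> 'I_n}) := \sum_(u | u \notin stray)
    \sum_(w | (w \notin stray) && (cluster u != cluster w))
       (T (x (cluster u)) w != T (x (cluster u)) (x (cluster w)) : nat).
have pointwise x : x \in family cluster_reps ->
    e * #|difference (induced x)| <= e * err x + 8 * n ^ 2.
  move=> xF.
  have le : #|difference (induced x)| <= err x + \sum_u \sum_w
      ((u \in stray) + (w \in stray) + (w %% e == u %% e)
       + (u \notin stray) * (T u w != T (x (cluster u)) w)).
    have -> : #|difference (induced x)| =
        \sum_u \sum_w (T u w && ~~ induced x u w : nat).
      rewrite pair_bigA -sum1_card big_mkcond /=.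
      by apply: eq_bigr => p _; rewrite inE.
    rewrite /err [X in X + _]big_mkcond -big_split; apply: leq_sum => u _ /=.
    rewrite (_ : (if _ then _ else 0) = \sum_w
       if (u \notin stray) && (w \notin stray) && (cluster u != cluster w) then
         (T (x (cluster u)) w != T (x (cluster u)) (x (cluster w)) : nat) else 0); last first.
      by case: (u \notin stray); rewrite ?big1_eq // big_mkcond.
    rewrite -big_split; apply: leq_sum => w _ /=; rewrite /induced.
    have [us|us] := boolP (u \in stray); first by case: (_ && _); rewrite /=; lia.
    have [ws|ws] := boolP (w \in stray); first by case: (_ && _); rewrite /=; lia.
    have [cuw|_] /= := eqVneq (cluster u) (cluster w).
      have := precluster_nonstray us; have := precluster_nonstray ws; rewrite -cuw.
      case: (cluster u) => i k /precluster_mod -> /precluster_mod ->.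
      by rewrite eqxx; case: (_ && _).
    by case: (T u w); case: (T _ w); case: (T _ _) => //=; rewrite ?orbT; lia.
  apply: leq_trans (leq_mul (leqnn e) le) _; rewrite mulnDr leq_add2l.
  apply: (@leq_trans (\sum_(u : 'I_n) ((e * n) * (u \in stray) + 6 * n))).
    rewrite big_distrr; apply: leq_sum => u _ /=.
    rewrite !big_split /= sum_nat_const card_ord !mulnDr -!addnA leq_add //.
      by rewrite mulnA.
    have c1 : \sum_(w : 'I_n) (w \in stray) = #|stray|.
      by rewrite -sum1_card [RHS]big_mkcond.
    have c2 : \sum_(w : 'I_n) (w %% e == u %% e) = #|[set w : 'I_n | w %% e == u %% e]|.
      by rewrite -sum1_card [RHS]big_mkcond; apply: eq_bigr => w _; rewrite inE.
    have c3 : e * \sum_(w : 'I_n) (u \notin stray) * (T u w != T (x (cluster u)) w) <= 2 * n.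
      have [us|us] /= := boolP (u \in stray); first by rewrite big1 ?muln0.
      under eq_bigr do rewrite mul1n.
      have := precluster_disagreement (precluster_nonstray us)
                (precluster_rep xF (big_clusterP u)).
      congr (_ * _ <= _); rewrite /disagreement -sum1_card big_mkcond.
      by apply: eq_bigr => w _; rewrite inE.
    rewrite c1 c2 (_ : 6 * n = 2 * n + (2 * n + 2 * n)); last by lia.
    apply: leq_add card_stray (leq_add (leq_trans (card_residue_class u e_gt0) _) c3).
    by move: n_big e_gt0; clear; lia.
  rewrite big_split -big_distrr /= sum_nat_const card_ord.
  have -> : \sum_(u : 'I_n) (u \in stray) = #|stray|.
    by rewrite -sum1_card [RHS]big_mkcond.
  have := card_stray; nia.
apply: (@leq_trans (\sum_(x in family cluster_reps) (e * err x + 8 * n ^ 2))).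
  by rewrite big_distrr; apply: leq_sum.
rewrite big_split -big_distrr sum_nat_const /=.
apply: leq_trans (leq_add sum_rep_error (leqnn _)) _.
by rewrite -mulnDr -mulnDl.
Qed.

Variables (h : nat) (H : rel 'I_h).

(** By Markov's inequality, with 22 twice the mean bound 11, half of the choices of representatives
    induce a tournament that contains [H]. In [P], the factor 2 stands for this half,
    [(s * e) ^ h * h ^ h] for the choice of a most frequent pattern of clusters and ranks, and
    [(s * e ^ 2) ^ h] for the passage from cluster members to arbitrary vertices. *)
Lemma many_homs_of_covered :
  let P := 2 * ((s * e) ^ h * h ^ h) * (s * e ^ 2) ^ h in
  (forall T' : rel 'I_n, (forall u, ~~ T' u u) ->
     (forall u w, u != w -> T' u w != T' w u) ->
     (forall phi, phi \in homs H T' -> ~~ injectiveb phi) ->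
     22 * n ^ 2 <= e * #|difference T'|) ->
  2 * P ^ ((2 ^ h) ^ h) * (h * 2 ^ h) ^ 2 <= n ->
  n ^ h <= 2 * P ^ ((2 ^ h) ^ h) * (h * 2 ^ h) ^ h * #|homs H T|.
Proof.
move=> P Tfar n_large.
set Pi := #|family cluster_reps|.
pose good := [set x in family cluster_reps | e * #|difference (induced x)| < 22 * n ^ 2].
have s_gt0 : 0 < s.
  by have [[[i i_lt] _] _] := ex_big_cluster; apply: leq_ltn_trans i_lt.
have cgood : Pi <= 2 * #|good|.
  pose bad := [set x in family cluster_reps | 22 * n ^ 2 <= e * #|difference (induced x)|].
  have cbad : #|bad| * (22 * n ^ 2) <= Pi * (11 * n ^ 2).
    apply: leq_trans sum_difference; rewrite -sum_nat_const big_distrr /=.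
    rewrite [leqRHS]big_mkcond [leqLHS]big_mkcond; apply: leq_sum => x _.
    by rewrite inE; case: (x \in family _) => //=; case: ifP.
  have n2_gt0 : 0 < n ^ 2 by rewrite expn_gt0 n_gt0.
  move: cbad; rewrite mulnA [leqRHS]mulnA (leq_pmul2r n2_gt0) => cbad.
  have PiE : Pi = #|good| + #|bad|.
    pose Fam := [set x in family cluster_reps].
    have -> : Pi = #|Fam| by rewrite cardsE.
    rewrite -(cardsID [set x | e * #|difference (induced x)| < 22 * n ^ 2] Fam).
    congr (_ + _); apply: eq_card => x; rewrite !inE //.
    by rewrite -leqNgt andbC.
  by move: cbad; rewrite PiE; set x := #|good|; set z := #|bad|; clear; lia.
pose Q (p : {ffun 'I_h -> J} * {ffun 'I_h -> 'I_h}) := [set x in family cluster_reps |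
  [&& injectiveb p.2, [forall a, big_cluster (p.1 a)],
      [forall a, forall b, H a b && (p.1 a == p.1 b) ==> (p.2 a < p.2 b)] &
      [forall a, forall b, H a b && (p.1 a != p.1 b) ==> T (x (p.1 a)) (x (p.1 b))]]].
have goodQ : good \subset \bigcup_p Q p.
  apply/subsetP => x; rewrite inE => /andP[xF]; rewrite ltnNge => nfar.
  have [phi phiH phi_inj] : exists2 phi, phi \in homs H (induced x) & injectiveb phi.
    apply/exists_inP; apply: contraR nfar; rewrite negb_exists_in => /forall_inP none.
    apply: Tfar => // [u|u w uw]; first by rewrite /induced eqxx ltnn.
    exact: induced_total.
  (* Inside a cluster the induced tournament follows the vertex order, so the order of the values of
     [phi] ranks the vertices of [H]. *)
  have [kappa kinj kmono] := rank_of_key (fun a => val (phi a)).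
  move: phiH; rewrite inE => /forallP phiH.
  apply/bigcupP; exists ([ffun a => cluster (phi a)], [ffun a => kappa a]) => //.
  rewrite inE xF /=; apply/and4P; split.
  - by apply/injectiveP => a b; rewrite !ffunE => /kinj.
  - by apply/forallP => a; rewrite ffunE big_clusterP.
  - apply/forallP => a; apply/forallP => b; rewrite !ffunE; apply/implyP => /andP[Hab cab].
    by have /forallP/(_ b)/implyP/(_ Hab) := phiH a; rewrite /induced cab; apply: kmono.
  - apply/forallP => a; apply/forallP => b; rewrite !ffunE; apply/implyP => /andP[Hab cab].
    by have /forallP/(_ b)/implyP/(_ Hab) := phiH a; rewrite /induced (negbTE cab).
have Pi_gt0 : 0 < Pi.
  apply/card_gt0P; have /fin_all_exists[f fP] (j : J) : exists v, v \in cluster_reps j.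
    rewrite /cluster_reps; case: ifP => [|_]; last by exists (Ordinal n_gt0); rewrite inE.
    rewrite /big_cluster => jb; apply/set0Pn; rewrite -card_gt0.
    by case: #|_| jb => //; rewrite muln0 leqNgt n_gt0.
  by exists (finfun f); apply/familyP => j; rewrite ffunE.
have good_gt0 : 0 < #|good|.
  rewrite lt0n; apply: contraTneq Pi_gt0 => g0.
  by rewrite -leqNgt (leq_trans cgood) // g0.
have [[gam kap] cQ] : exists p, #|good| <= #|{: {ffun 'I_h -> J} * {ffun 'I_h -> 'I_h}}| * #|Q p|.
  apply: ex_large_term => //.
  exact: leq_trans (subset_leq_card goodQ) (card_bigcup_le _).
rewrite card_prod !card_ffun card_prod !card_ord in cQ.
have /set0Pn[x0] : Q (gam, kap) != set0.
  rewrite -card_gt0 lt0n; apply: contraTneq good_gt0 => Q0.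
  by rewrite -leqNgt (leq_trans cQ) // Q0 muln0.
rewrite inE => /andP[_ /and4P[/= /injectiveP kinj /forallP gbig /forallP kmono _]].
(* Only the clusters that meet the copy of [H] are blown up; there are at most [h] of them. *)
pose D := {j : J | j \in codom gam}.
pose gamD a : D := Sub (gam a) (codom_f gam a).
pose E := [set z : {ffun D -> 'I_n} | [forall a, forall b,
     H a b && (gamD a != gamD b) ==> T (z (gamD a)) (z (gamD b))]].
have cgam : #|codom gam| <= h.
  by have := leq_image_card gam 'I_h; rewrite card_ord.
have cD : #|{: D}| <= h.
  by rewrite card_sig.
have se_gt0 : 0 < s * e ^ 2 by rewrite muln_gt0 s_gt0 expn_gt0 e_gt0.
(* Freeing the coordinates in [D] enlarges the family of representatives by a factor of at most
   [(s * e ^ 2) ^ h], because the clusters in the image of [gam] are big. *)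
have cE : #|Q (gam, kap)| * n ^ #|{: D}| <= #|E| * (Pi * (s * e ^ 2) ^ h).
  pose reps' j := if j \in codom gam then [set: 'I_n] else cluster_reps j.
  have cfam' : #|family reps'| <= Pi * (s * e ^ 2) ^ h.
    have famE (F : J -> {set 'I_n}) : #|family F| = \prod_j #|F j|.
      by rewrite card_family foldrE big_map big_enum.
    rewrite /Pi !famE.
    apply: (@leq_trans (\prod_j (#|cluster_reps j| * if j \in codom gam then s * e ^ 2 else 1))).
      apply: leq_prod => j _; rewrite /reps'; case: ifP => [/codomP[a ->]|_]; last by rewrite muln1.
      by rewrite cardsT card_ord /cluster_reps gbig mulnC; exact: gbig.
    rewrite big_split leq_mul2l /= -big_mkcond prod_nat_const; apply/orP; right.
    by rewrite leq_pexp2l.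
  apply: leq_trans (leq_mul (leqnn _) cfam').
  have g_inj : injective (@swap_along _ _ 'I_n (val : D -> J)).
    by apply/inv_inj/swap_alongK/val_inj.
  have cT : #|[set: {ffun D -> 'I_n}]| = n ^ #|{: D}| by rewrite cardsT card_ffun card_ord.
  rewrite -cT -[#|family reps'|]cardsE -!cardsX [leqRHS]cardsX mulnC -cardsX -(card_imset _ g_inj).
  apply: subset_leq_card; apply/subsetP => _ /imsetP[[x xi] + ->].
  rewrite !inE andbT /= => /andP[/familyP xF /and4P[_ _ _ /forallP xT]]; apply/andP; split.
    apply/forallP => j; rewrite /reps'; case: ifP => [_|jD]; first by rewrite inE.
    by rewrite overwrite_out ?xF // => d; apply: contraFneq jD => <-; exact: valP.
  apply/forallP => a; apply/forallP => b; have /forallP/(_ b) := xT a.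
  by rewrite !ffunE -val_eqE.
have PE : #|'I_n| ^ #|{: D}| <= P * #|E|.
  rewrite card_ord -(leq_pmul2l Pi_gt0).
  apply: leq_trans (leq_mul cgood (leqnn _)) _.
  apply: leq_trans (leq_mul (leq_mul (leqnn 2) cQ) (leqnn _)) _.
  move: cE; rewrite /P; set a := (s * e) ^ h * h ^ h; set b := _ ^ h => cE.
  have := leq_mul (leqnn (2 * a)) cE; congr (_ <= _); lia.
have h_pos : 0 < h ^ h by case: {+}h => // h'; rewrite expn_gt0.
have P_gt0 : 0 < P.
  by rewrite !muln_gt0 h_pos !expn_gt0 !muln_gt0 s_gt0 e_gt0.
have := @homs_of_clusters h H 'I_n D T gamD kap P.
rewrite (card_ord n) in PE *; apply => //.
- by move=> u w uw; rewrite T_total // orNb.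
- move=> a b Hab /(congr1 val) /= gab; have /forallP/(_ b)/implyP := kmono a.
  by apply; rewrite Hab gab eqxx.
Qed.

End Clusters.

(** * Choice of the polynomial parameters *)

Lemma bernoulli (d m : nat) : d ^ m * (d + m) <= d * d.+1 ^ m.
Proof.
elim: m => [|m IHm]; first by rewrite mul1n addn0 muln1.
rewrite !expnS [leqRHS]mulnCA; have := leq_mul (leqnn d.+1) IHm.
set x := d ^ m; set z := d * _; move=> le; apply: leq_trans le; nia.
Qed.

Lemma leq_exp_pred (e : nat) : 1 < e -> 2 * e.-1 ^ e <= e ^ e.
Proof.
case: e => [|[|d]] // _ /=; have bern := bernoulli d.+1 d.+2.
rewrite -(leq_pmul2l (ltn0Sn d)); apply: leq_trans bern.
by set x := _ ^ _; nia.
Qed.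

(** With [m = e %/ a.+1], the chain is [e ^ a <= (m.+1 * a.+1) ^ a <= m.+1 ^ a.+1 <= 2 ^ (m *
    a.+1)]. *)
Lemma poly_leq_exp2 (a e : nat) : a.+1 ^ a.+1 <= e -> e ^ a <= 2 ^ e.
Proof.
move=> e_big; pose m := e %/ a.+1.
have e_lt : e < m.+1 * a.+1 by rewrite -ltn_divLR.
have m_big : a.+1 ^ a <= m by rewrite leq_divRL // -expnSr.
apply: (@leq_trans (m.+1 ^ a.+1)).
  apply: (@leq_trans ((m.+1 * a.+1) ^ a)); first by case: {+}a e_lt => // a' lt; rewrite leq_exp2r // ltnW.
  by rewrite expnMn expnSr leq_mul2l (leq_trans m_big) ?orbT // leqnSn.
apply: (@leq_trans ((2 ^ m) ^ a.+1)); first by rewrite leq_exp2r // ltn_expl.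
by rewrite -expnM leq_pexp2l // leq_trunc_div.
Qed.

Lemma poly_many_homs (h : nat) (H : rel 'I_h) (A : {set 'I_h}) (kappa : 'I_h -> 'I_h) :
  (forall x y, H x y -> ~~ H y x) -> injective kappa ->
  (forall x y, H x y -> (x \in A) = (y \in A) -> kappa x < kappa y) ->
  exists C e0, forall e, e0 <= e -> exists N, forall n, N <= n -> forall T : rel 'I_n,
    (forall u w, u != w -> T u w = ~~ T w u) ->
    (forall T' : rel 'I_n, (forall u, ~~ T' u u) ->
       (forall u w, u != w -> T' u w != T' w u) ->
       (forall phi, phi \in homs H T' -> ~~ injectiveb phi) ->
       22 * n ^ 2 <= e * #|difference T T'|) ->
    n ^ h <= e ^ C * #|homs H T|.
Proof.
move=> Hanti kinj kmono.
have [h0|h_gt0] := posnP h.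
  exists 0, 0 => e _; exists 0 => n _ T _ _; rewrite {1}h0 mul1n.
  have /card_gt0P[phi _] : 0 < #|{ffun 'I_h -> 'I_n}| by rewrite card_ffun !card_ord {1}h0.
  rewrite card_gt0; apply/set0Pn; exists phi.
  by rewrite inE; apply/forallP => a; have := ltn_ord a; rewrite {2}h0.
pose k := 2 ^ (h * #|{set 'I_(2 ^ h)}|).
pose B := (2 ^ h) ^ h.
pose p := 1 + ((3 * k + 4) * h + h) + (3 * k + 5) * h.
exists (4 + (3 * k + 4) * h + (1 + p * B + h)), (3 + h * 2 ^ h + (6 * k + 7).+1 ^ (6 * k + 7).+1).
move=> e e_big.
have e_gt2 : 2 < e by lia.
have e_gt1 : 1 < e by lia.
have e_gt0 : 0 < e by lia.
have eh : h * 2 ^ h <= e by lia.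
have hh : h <= e by apply: leq_trans eh; rewrite leq_pmulr // expn_gt0.
have eE a b : a <= b -> e ^ a <= e ^ b by move=> ?; rewrite leq_pexp2l.
(* Since [(1 - 1 / e) ^ e <= 1 / 2], the choice of [t] gives a failure probability of at most
   [2 ^ - e] per pair, which beats the polynomial [2 * s ^ 2]. As [t.+1 <= e ^ 3], the sample size
   [s] exceeds [2 * e * t.+1 ^ k]. *)
pose t := e ^ 2; pose s := e ^ (3 * k + 3).
pose P := 2 * ((s * e) ^ h * h ^ h) * (s * e ^ 2) ^ h.
have leP : P <= e ^ p.
  rewrite /P /p !expnD expn1 leq_mul //; last first.
    by rewrite /s -expnD -expnM eE // leq_mul2r -addnA leqnn orbT.
  rewrite leq_mul // leq_mul //; last by case: {+}h hh => // h' hh; rewrite leq_exp2r.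
  by rewrite /s -expnSr -expnM eE // leq_mul2r -addnS leqnn orbT.
have s_gt0 : 0 < s by rewrite expn_gt0 e_gt0.
have le8 : 8 * e <= e ^ 4 by rewrite expnSr leq_mul2r (@leq_exp2r 2 _ 3) // e_gt1 orbT.
have le_st : s + t <= e ^ (3 * k + 4).
  rewrite addnS expnSr -/s; have : t <= s by rewrite /t /s eE //; lia.
  nia.
have s_big : 2 * e * t.+1 ^ k < s.
  have t1 : t.+1 <= e ^ 3 by rewrite expnSr -/t /t; nia.
  have t2 : t.+1 ^ k <= e ^ (3 * k).
    by rewrite expnM; case: {+}k => // k'; rewrite leq_exp2r.
  apply: (@leq_ltn_trans (e ^ (3 * k + 2))); last by rewrite ltn_exp2l // ltn_add2l.
  rewrite expnD [leqRHS]mulnC leq_mul // expnS expn1; nia.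
have t_big : 2 * s ^ 2 * e.-1 ^ t <= e ^ t.
  apply: (@leq_trans (2 ^ e * e.-1 ^ t)).
    rewrite leq_mul2r; apply/orP; right.
    apply: (@leq_trans (e ^ (6 * k + 7))); last by apply: poly_leq_exp2; lia.
    have -> : 6 * k + 7 = ((3 * k + 3) * 2).+1 by lia.
    by rewrite [leqRHS]expnS leq_mul // -expnM.
  by rewrite /t -mulnn !expnM -expnMn leq_exp2r // leq_exp_pred.
exists (8 * e * (s + t) ^ 2 + 2 * P ^ B * (h * 2 ^ h) ^ 2 + 2 * e) => n n_big T T_total Tfar.
have [n_st n_large n_big2] : [/\ 8 * e * (s + t) ^ 2 <= n,
    2 * P ^ B * (h * 2 ^ h) ^ 2 <= n & 2 * e <= n].
  by move: n_big; move: (8 * _ * _) (2 * _ * _) (2 * e); clear => a b c abc; split; lia.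
have V_gt0 : 0 < #|'I_n| by rewrite card_ord (leq_trans _ n_big2) // muln_gt0.
have [/existsP[y covered]|] := boolP [exists y : {ffun 'I_s -> 'I_n},
    e * #|[set u | [forall i, far T e (y i) u]]| <= n].
  apply: leq_trans (many_homs_of_covered T_total e_gt2 n_big2 covered Tfar n_large) _.
  rewrite leq_mul2r; apply/orP; right; rewrite -/B -/P.
  apply: (@leq_trans (e ^ (1 + p * B + h))); last by apply: eE; rewrite leq_addl.
  have B_gt0 : 0 < B by rewrite !expn_gt0.
  rewrite (expnD e _ h) (expnD e 1) expn1 leq_mul //; last by rewrite leq_exp2r.
  by rewrite leq_mul // (expnM e p B) leq_exp2r.
rewrite negb_exists => /forallP uncovered.
have := @many_homs_of_uncovered _ T e s _ T_total h H A kappa h_gt0 Hanti kinj kmono t.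
rewrite card_ord; move=> many.
apply: leq_trans (many _ _ _ _ _ _) _ => //.
- by move=> y; rewrite ltnW // ltnNge uncovered.
- by rewrite card_ord in V_gt0.
rewrite leq_mul2r; apply/orP; right.
apply: (@leq_trans (e ^ (4 + (3 * k + 4) * h))); last by apply: eE; rewrite leq_addr.
by rewrite (expnD e 4) leq_mul // (expnM e _ h) leq_exp2r.
Qed.

(** * Feedback graphs *)

(** If all degrees in [D] are at least 2, a path that never turns back must close up. Otherwise a
    vertex with at most one neighbour in [D] is removed, and the colouring of the rest extends to
    it. *)
Lemma ex_cycle_of_not_bipartite (T : finType) (e : rel T) :
  symmetric e -> irreflexive e ->
  (forall f : T -> bool, exists x y, e x y /\ f x = f y) ->
  exists c : seq T, [/\ uniq c, 2 < size c & cycle e c].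
Proof.
move=> e_sym e_irr not2.
suff main m (D : {set T}) : #|D| = m ->
    (exists c : seq T, [/\ uniq c, 2 < size c & cycle e c]) \/
    exists f : T -> bool, {in D &, forall x y, e x y -> f x != f y}.
  have [//|[f fP]] := main _ [set: T] erefl.
  by have [x [y [exy fxy]]] := not2 f; have := fP x y; rewrite !inE fxy eqxx; move/(_ isT isT exy).
elim: m D => [|m IHm] D cD.
  by right; exists xpredT => x y; rewrite (cards0_eq cD) inE.
have [deg2|] := boolP [forall x in D, exists y1 in D, exists y2 in D,
    [&& y1 != y2, e x y1 & e x y2]].
  left; have long k : exists x p, [/\ k <= size p, path e x p, uniq (x :: p) & {subset x :: p <= D}]
      \/ exists c : seq T, [/\ uniq c, 2 < size c & cycle e c].
    elim: k => [|k [x [p [[kp xp up pD]|cyc]]]]; last by exists x, p; right.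
      have [x xD] : exists x, x \in D by apply/set0Pn; rewrite -card_gt0 cD.
      by exists x, [::]; left; split=> // y; rewrite inE => /eqP ->.
    (* The path grows at its head [x]; [y] avoids the vertex after [x]. For empty [p] the default
       excludes [x] itself, which is no neighbour of [x]. *)
    have [y [yD exy ya]] : exists y, [/\ y \in D, e x y & y != head x p].
      have := forall_inP deg2 x (pD x (mem_head _ _)).
      case/exists_inP => y1 y1D /exists_inP[y2 y2D /and3P[y12 e1 e2]].
      have [y1h|y1h] := eqVneq y1 (head x p); last by exists y1.
      by exists y2; rewrite -y1h eq_sym.
    have [yp|yp] := boolP (y \in p).
      exists x, p; right; case: p {kp pD} yp xp up ya => // a p.
      rewrite inE => /orP[/eqP ->|yp]; first by rewrite eqxx.
      move=> /=/andP[exa ap] up _; case/splitPr: yp ap up => p1 p2.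
      rewrite cat_path /= => /and3P[ap1 ly _] up.
      exists (x :: a :: rcons p1 y); split => //.
        have : uniq ((x :: a :: rcons p1 y) ++ p2) by rewrite /= cat_rcons.
        by rewrite cat_uniq => /andP[].
        by rewrite /= size_rcons.
      by rewrite /= exa rcons_path rcons_path ap1 ly last_rcons e_sym.
    exists y, (x :: p); left; split=> //; first by rewrite /= e_sym exy.
      rewrite cons_uniq up andbT inE negb_or yp andbT.
      by apply: contraTneq exy => ->; rewrite e_irr.
    by move=> z; rewrite inE => /orP[/eqP ->|/pD].
  have [x [p [[sp _ up _]|//]]] := long #|T|.
  have := max_card (mem (x :: p)); rewrite (card_uniqP up) /= => le.
  by rewrite ltnNge sp in le.
case/forall_inPn => x xD /exists_inPn leaf.
have cDx : #|D :\ x| = m by move: cD; rewrite (cardsD1 x) xD => -[].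
have [cyc|[f fP]] := IHm _ cDx; first by left.
right; pose g z := if z == x then
  (if [pick y in D | e x y] is Some y then ~~ f y else true) else f z.
have gx y : y \in D -> e x y -> f y = ~~ g x.
  move=> yD exy; rewrite /g eqxx; case: pickP => [y' /andP[y'D exy']|/(_ y)]; last by rewrite yD exy.
  rewrite negbK; congr f; apply/eqP; apply: contraT => yy'.
  by have /exists_inPn/(_ y' y'D) := leaf y yD; rewrite yy' exy exy'.
have xy_neq y z : e y z -> y != z by apply: contraTneq => ->; rewrite e_irr.
exists g => y z yD zD eyz; have [yx|yx] := eqVneq y x.
  rewrite yx in eyz *; have zx : z != x by rewrite eq_sym xy_neq.
  by rewrite {2}/g (negbTE zx) (gx z) //; case: (g x).
have [zx|zx] := eqVneq z x.
  by rewrite {1}/g (negbTE yx) zx (gx y) // 1?e_sym -?zx //; case: (g z).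
by rewrite /g (negbTE yx) (negbTE zx); apply: fP; rewrite ?inE ?yx ?zx.
Qed.

Section FeedbackGraphs.
Variables (h : nat) (H : rel 'I_h).
Local Notation graph := {set 'I_h * 'I_h}.
Implicit Types B : graph.

Definition graph_hom B1 B2 (p : 'I_h -> 'I_h) :=
  [forall x, forall y, ((x, y) \in B1) ==> ((p x, p y) \in B2)].

Lemma graph_homP B1 B2 p :
  reflect (forall x y, (x, y) \in B1 -> (p x, p y) \in B2) (graph_hom B1 B2 p).
Proof.
apply: (iffP forallP) => [hom x y|hom x]; last by apply/forallP => y; apply/implyP/hom.
by have /forallP/(_ y)/implyP := hom x.
Qed.

(* Equivalently, [B] contains the backedge graph of [H] for some linear order. *)
Definition feedback B :=
  [&& [forall x, forall y, ((x, y) \in B) ==> ((y, x) \in B)],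
      [forall x, (x, x) \notin B] &
      [exists k : {ffun 'I_h -> 'I_h}, [forall x, forall y,
         H x y ==> ((x, y) \in B) || (k x < k y)]]].

Lemma feedbackP B : reflect
  [/\ forall x y, (x, y) \in B -> (y, x) \in B, forall x, (x, x) \notin B &
      exists k : 'I_h -> nat, forall x y, H x y -> (x, y) \notin B -> k x < k y]
  (feedback B).
Proof.
apply: (iffP and3P) => -[sym irr key]; split.
- by move=> x y; have /forallP/(_ x)/forallP/(_ y)/implyP := sym.
- exact/forallP.
- case/existsP: key => k /forallP kP; exists (fun x => val (k x)) => x y Hxy nB.
  by have /forallP/(_ y)/implyP/(_ Hxy) := kP x; rewrite (negbTE nB).
- by apply/forallP => x; apply/forallP => y; apply/implyP/sym.
- exact/forallP.
- have [k kP] := key.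
  have [r _ rmono] := rank_of_key k.
  apply/existsP; exists (finfun r); apply/forallP => x; apply/forallP => y; apply/implyP => Hxy.
  rewrite !ffunE; have [//|nB] := boolP ((x, y) \in B); apply: rmono; exact: kP.
Qed.

(** [B] minimises the number of feedback graphs that map to it. If [B'] maps to [B] but not
    conversely, then the graphs mapping to [B'] also map to [B], and [B] itself is missing among
    them. The complete graph shows that a feedback graph exists. *)
Lemma ex_minimal_feedback : (forall x, ~~ H x x) ->
  exists2 B, feedback B & forall B' p, feedback B' -> graph_hom B' B p ->
    exists g, graph_hom B B' g.
Proof.
move=> Hirr.
pose B0 : graph := [set p | p.1 != p.2].
have B0f : feedback B0.
  apply/feedbackP; split=> [x y|x|]; rewrite ?inE ?eqxx //= 1?eq_sym //.
  exists (fun _ => 0) => x y Hxy; rewrite inE negbK /= => /eqP E.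
  by move: Hxy; rewrite E (negbTE (Hirr y)).
pose homb B' B := [exists p : {ffun 'I_h -> 'I_h}, graph_hom B' B p].
pose mu B := #|[set B' | feedback B' && homb B' B]|.
have [B Bf Bmin] := arg_minnP mu B0f; exists B => // B' p B'f pP.
have [/existsP[g gP]|nhom] := boolP (homb B B'); first by exists g.
have := Bmin B' B'f; rewrite leqNgt => /negP[].
have homb_fun B1 B2 q : graph_hom B1 B2 q -> homb B1 B2.
  move=> /graph_homP qP; apply/existsP; exists (finfun q).
  by apply/graph_homP => x y /qP; rewrite !ffunE.
apply: proper_card; apply/properP; split.
  apply/subsetP => B''; rewrite !inE => /andP[-> /existsP[q /graph_homP qP]] /=.
  apply: (homb_fun _ _ (p \o q)); apply/graph_homP => x y /qP; exact: (graph_homP _ _ _ pP).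
exists B; rewrite !inE Bf //=; apply: (homb_fun _ _ id); apply/graph_homP => //.
Qed.

Definition induced_edges B (K : {set 'I_h}) := [set p in B | (p.1 \in K) && (p.2 \in K)].

(** For [g] from [B] back to [B'], the endomorphism [r \o p \o g] permutes the image [K] of [r], by
    minimality of the image, and hence also the edges inside [K]. The map [z] is [g] after the
    inverse of this permutation. *)
Lemma ex_rigid_retract B :
  (forall B' p, feedback B' -> graph_hom B' B p -> exists g, graph_hom B B' g) ->
  exists r : 'I_h -> 'I_h, graph_hom B B r /\
    forall B' p, feedback B' -> graph_hom B' B p ->
    exists z : 'I_h -> 'I_h, forall v w,
      (v, w) \in induced_edges B (r @: setT) -> (z v, z w) \in B' /\ r (p (z v)) = v.
Proof.
move=> Bmin.
have idP : graph_hom B B (finfun id : {ffun 'I_h -> 'I_h}).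
  by apply/graph_homP => x y; rewrite !ffunE.
have [r rP rmin] := @arg_minnP _ _ (fun r : {ffun 'I_h -> 'I_h} => graph_hom B B r)
  (fun r => #|r @: setT|) idP.
exists r; split=> // B' p B'f pP; have [g gP] := Bmin _ _ B'f pP.
set K := r @: setT; pose e := r \o p \o g.
have eP : graph_hom B B e.
  apply/graph_homP => x y /(graph_homP _ _ _ gP)/(graph_homP _ _ _ pP).
  exact: (graph_homP _ _ _ rP).
have eK : e @: K = K.
  apply/eqP; rewrite eqEcard; apply/andP; split.
    by apply/subsetP => _ /imsetP[x _ ->]; rewrite /e /= imset_f.
  have erP : graph_hom B B (finfun (e \o r)).
    apply/graph_homP => x y /(graph_homP _ _ _ rP)/(graph_homP _ _ _ eP).
    by rewrite !ffunE.
  apply: leq_trans (rmin _ erP) _; rewrite subset_leq_card //.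
  by apply/subsetP => _ /imsetP[x _ ->]; rewrite ffunE /= imset_f // imset_f.
have e_inj : {in K &, injective e} by apply/imset_injP; rewrite eK.
pose ee (q : 'I_h * 'I_h) := (e q.1, e q.2).
have ee_inj : {in induced_edges B K &, injective ee}.
  move=> [v w] [v' w']; rewrite !inE /= => /and3P[_ vK wK] /and3P[_ v'K w'K] [].
  by move=> /e_inj -> // /e_inj ->.
have eeE : ee @: induced_edges B K = induced_edges B K.
  apply/eqP; rewrite eqEcard card_in_imset // leqnn andbT.
  apply/subsetP => _ /imsetP[[v w] + ->]; rewrite !inE /= => /and3P[vw vK wK].
  by rewrite (graph_homP _ _ _ eP) //= -eK !imset_f.
pose u v := odflt v [pick x in K | e x == v].
have uE x : x \in K -> u (e x) = x.
  move=> xK; rewrite /u; case: pickP => [y /andP[yK /eqP/e_inj -> //]|/(_ x)].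
  by rewrite xK eqxx.
exists (g \o u) => v w; rewrite -{1}eeE => /imsetP[[x y] + [-> ->]].
rewrite !inE /= => /and3P[xy xK yK]; rewrite !uE //; split => //.
exact: (graph_homP _ _ _ gP).
Qed.

End FeedbackGraphs.

(** * Grid tournaments *)

(* A convex combination of points of a sphere lies on the sphere only if the points agree:
   sum_l (c_{l+1} - c_l) |a_l - a|^2 = 0. *)
Lemma sphere_rigidity (t m : nat) (y : nat -> 'I_t -> int) (c : nat -> int)
    (a : nat -> 'I_t -> int) (a' : 'I_t -> int) (rho : int) :
  (forall l, (l < m)%N -> (c l < c l.+1)%R) ->
  (forall l k, (l < m)%N -> (y l.+1 k - y l k = (c l.+1 - c l) * a l k)%R) ->
  (forall k, (y m k - y 0%N k = (c m - c 0%N) * a' k)%R) ->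
  (forall l, (l < m)%N -> (\sum_k a l k ^+ 2 = rho)%R) -> (\sum_k a' k ^+ 2 = rho)%R ->
  forall l k, (l < m)%N -> a l k = a' k.
Proof.
move=> c_mono step close a_rho a'_rho.
have telescope (f : nat -> int) : (\sum_(l < m) (f l.+1 - f l) = f m - f 0%N)%R.
  elim: {close c_mono step a_rho} m => [|m IH]; first by rewrite big_ord0 subrr.
  by rewrite big_ord_recr /= IH; ring.
(* As both points have norm [rho], the squared distance is [2 * rho] minus twice an inner product;
   both contributions telescope along the cycle and cancel. *)
have sum0 : (\sum_(l < m) (c l.+1 - c l) * \sum_k (a l k - a' k) ^+ 2 = 0)%R.
  have E (l : 'I_m) : ((c l.+1 - c l) * \sum_k (a l k - a' k) ^+ 2 =
      2 * rho * (c l.+1 - c l) - 2 * \sum_k a' k * (y l.+1 k - y l k))%R.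
    have -> : (\sum_k (a l k - a' k) ^+ 2 = 2 * rho - 2 * \sum_k a' k * a l k)%R.
      rewrite (_ : (2 * rho = rho + rho)%R); last by ring.
      rewrite -{1}(a_rho _ (ltn_ord l)) -a'_rho -big_split /= mulr_sumr -sumrB.
      by apply: eq_bigr => k _; ring.
    have -> : (\sum_k a' k * (y l.+1 k - y l k) = (c l.+1 - c l) * \sum_k a' k * a l k)%R.
      by rewrite mulr_sumr; apply: eq_bigr => k _; rewrite step //; ring.
    by ring.
  rewrite (eq_bigr _ (fun l _ => E l)) sumrB -mulr_sumr telescope -mulr_sumr exchange_big /=.
  rewrite (eq_bigr (fun k => (c m - c 0%N) * a' k ^+ 2)%R) => [|k _].
    by rewrite -mulr_sumr a'_rho; ring.
  by rewrite -mulr_sumr (telescope (fun l => y l k)) close; ring.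
move=> l k lm; apply/eqP; rewrite -subr_eq0 -(sqrf_eq0 (a l k - a' k)%R).
have sq_ge0 (l' : 'I_m) : (0 <= \sum_k (a l' k - a' k) ^+ 2 :> int)%R.
  by apply: sumr_ge0 => k' _; rewrite sqr_ge0.
have term_ge0 (l' : 'I_m) : predT l' ->
    (0 <= (c l'.+1 - c l') * \sum_k (a l' k - a' k) ^+ 2 :> int)%R.
  by move=> _; rewrite mulr_ge0 // subr_ge0 ltW // c_mono.
have /eqP := psumr_eq0P term_ge0 sum0 (i := Ordinal lm) isT.
rewrite mulf_eq0 gt_eqF ?subr_gt0 ?c_mono //= => /eqP sq0.
apply/eqP; apply: (psumr_eq0P _ sq0) => // k' _; exact: sqr_ge0.
Qed.

(** The norm takes at most [t * b ^ 2 + 1] values; the most frequent one is chosen. *)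
Lemma ex_large_sphere (t b : nat) : 0 < b -> exists rho, exists S : {set {ffun 'I_t -> 'I_b}},
  (forall a, a \in S -> \sum_k a k ^ 2 = rho) /\ b ^ t <= (t * b ^ 2).+1 * #|S|.
Proof.
move=> b_gt0; pose N := t * b ^ 2.
have norm_lt (a : {ffun 'I_t -> 'I_b}) : \sum_k a k ^ 2 < N.+1.
  rewrite ltnS /N -[X in _ <= X * _](card_ord t) -sum_nat_const; apply: leq_sum => k _.
  by rewrite leq_exp2r // ltnW.
pose Sr (r : 'I_N.+1) := [set a : {ffun 'I_t -> 'I_b} | Ordinal (norm_lt a) == r].
have [r rP] : exists r, b ^ t <= #|'I_N.+1| * #|Sr r|.
  apply: ex_large_term; first by rewrite expn_gt0 b_gt0.
  rewrite -[X in _ ^ X](card_ord t) -[X in X ^ _](card_ord b) -card_ffun -sum1_card.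
  rewrite (partition_big (fun a => Ordinal (norm_lt a)) predT) //= leq_eqVlt.
  apply/orP; left; apply/eqP; apply: eq_bigr => r _.
  by rewrite -sum1_card; apply: eq_bigl => a; rewrite inE.
exists (val r), (Sr r); split; last by rewrite card_ord in rP.
by move=> a; rewrite inE => /eqP <-.
Qed.

Section Construction.
Variables (h : nat) (H : rel 'I_h).
Hypotheses (Hirr : forall x, ~~ H x x) (Hanti : forall x y, H x y -> ~~ H y x).
Variables (B : {set 'I_h * 'I_h}) (key : 'I_h -> nat).
Hypotheses (B_sym : forall x y, (x, y) \in B -> (y, x) \in B)
  (B_irr : forall x, (x, x) \notin B)
  (keyP : forall x y, H x y -> (x, y) \notin B -> key x < key y).
Variables (r : 'I_h -> 'I_h) (cyc : seq 'I_h).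
Local Notation edge := (fun v w => (v, w) \in induced_edges B (r @: setT)).
Hypothesis rigid : forall B' p, feedback H B' -> graph_hom B' B p ->
  exists z : 'I_h -> 'I_h, forall v w, edge v w -> (z v, z w) \in B' /\ r (p (z v)) = v.
Hypotheses (cyc_uniq : uniq cyc) (cyc_size : 2 < size cyc) (cyc_cycle : cycle edge cyc).

(* The factor [c_x] of part [x]; it increases along [cyc]. *)
Definition slope (x : 'I_h) := index (r x) cyc * h + x.
(** Large enough that [x + slope i * a] stays below [dilation * n] for all [x] and [a] below [n]. *)
Definition dilation := (h.+1 * h).+1.

Lemma slope_inj : injective slope.
Proof. exact: lex_key_inj. Qed.

Lemma slope_lt x : slope x < dilation.
Proof.
have : size cyc <= h by rewrite -(card_uniqP cyc_uniq) -[leqRHS]card_ord max_card.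
move=> cyc_h; rewrite /slope /dilation ltnS mulSn addnC leq_add ?(ltnW (ltn_ord x)) //.
by rewrite leq_mul2r (leq_trans (index_size _ _)) ?orbT.
Qed.

Lemma slope_index x y : index (r x) cyc < index (r y) cyc -> slope x < slope y.
Proof. by have := ltn_ord x; rewrite /slope; nia. Qed.

Variables (t b N rho : nat) (S : {set {ffun 'I_t -> 'I_b}}).
Hypothesis S_sphere : forall a, a \in S -> \sum_k a k ^ 2 = rho.

(** A part, a grid point and an extra coordinate that [linked] ignores; the latter makes the host
    arbitrarily large for fixed [t] and [b]. *)
Local Notation vertex := ('I_h * {ffun 'I_t -> 'I_(dilation * b)} * 'I_(dilation * N))%type.

Implicit Types u v w : vertex.

(** The equation is [v - u = (c_v - c_u) * a], free of subtractions: both points have the form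
    [x + c_i * a] for one [x]. *)
Definition linked u v := ((u.1.1, v.1.1) \in B) && [exists a in S, [forall k,
  v.1.2 k + slope u.1.1 * a k == u.1.2 k + slope v.1.1 * a k]].

Definition position u := key u.1.1 * #|{: vertex}| + enum_rank u.

Definition host : rel vertex := fun u v =>
  if linked u v && H u.1.1 v.1.1 then true
  else if linked u v && H v.1.1 u.1.1 then false else position u < position v.

Lemma linkedC u v : linked u v = linked v u.
Proof.
rewrite /linked (_ : ((u.1.1, v.1.1) \in B) = ((v.1.1, u.1.1) \in B)).
  by congr (_ && _); apply: eq_existsb => a; congr (_ && _); apply: eq_forallb => k; rewrite eq_sym.
by apply/idP/idP; exact: B_sym.
Qed.

Lemma position_inj : injective position.
Proof.
move=> u v /(congr1 (modn^~ #|{: vertex}|)).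
by rewrite !modnMDl !modn_small // => /val_inj/enum_rank_inj.
Qed.

Lemma host_total u v : u != v -> host u v = ~~ host v u.
Proof.
move=> uv; rewrite /host linkedC; case: (linked v u) => /=.
  have := @Hanti u.1.1 v.1.1; case: (H u.1.1 _) => [/(_ isT)/negbTE -> //|_].
  case: (H v.1.1 _) => //; case: ltngtP => // /position_inj E; by rewrite E eqxx in uv.
by case: ltngtP => // /position_inj E; rewrite E eqxx in uv.
Qed.

Lemma host_irr u : ~~ host u u.
Proof. by rewrite /host /linked (negbTE (B_irr _)) /= ltnn. Qed.

(** Collinearity of the points of dimension [t + 1] formed by the slope and the grid point. *)
Definition collinear u v w := (u.1.1 != v.1.1) && [forall k,
  (((slope v.1.1)%:Z - (slope u.1.1)%:Z) * ((w.1.2 k : nat)%:Z - (u.1.2 k : nat)%:Z) ==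
   ((slope w.1.1)%:Z - (slope u.1.1)%:Z) * ((v.1.2 k : nat)%:Z - (u.1.2 k : nat)%:Z))%R].

(** The linked pairs of the copy form a feedback graph, ordered by [position], which maps to [B] by
    taking parts. So [rigid] yields linked pairs lying over [cyc], whose slopes increase until the
    last edge closes the cycle. By [sphere_rigidity] all directions along it agree, which aligns its
    first, second and last points. *)
Lemma homs_collinear phi : phi \in homs H host ->
  exists x y z, [/\ z != x, z != y & collinear (phi x) (phi y) (phi z)].
Proof.
rewrite inE => /forallP phiH.
pose B' := [set q : 'I_h * 'I_h | linked (phi q.1) (phi q.2)].
have B'f : feedback H B'.
  apply/feedbackP; split=> [x y|x|].
  - by rewrite !inE linkedC.
  - by rewrite inE /linked (negbTE (B_irr _)).
  - exists (fun x => position (phi x)) => x y Hxy; rewrite inE /= => nl.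
    by have /forallP/(_ y)/implyP/(_ Hxy) := phiH x; rewrite /host (negbTE nl).
have pP : graph_hom B' B (fun x => (phi x).1.1).
  by apply/graph_homP => x y; rewrite inE => /andP[].
have [z zP] := rigid B'f pP.
pose m := (size cyc).-1; have m_gt1 : 1 < m by move: cyc_size; rewrite /m; lia.
have [v0 [p cycE]] : exists (v0 : 'I_h) p, cyc = v0 :: p.
  by case: {+}cyc cyc_size => // v0 p _; exists v0, p.
pose v l := nth v0 cyc l.
have mE : m = size p by rewrite /m cycE.
have edges l : l < m -> edge (v l) (v l.+1).
  move=> lm; move: cyc_cycle; rewrite /v cycE /= => /(pathP v0)/(_ l).
  rewrite size_rcons -mE ltnS (ltnW lm) => /(_ isT).
  rewrite -rcons_cons !nth_rcons /= ltnS -mE (ltnW lm) lm //.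
have last_edge : edge (v m) (v 0).
  move: cyc_cycle; rewrite /v cycE /= => /(pathP v0)/(_ m).
  rewrite size_rcons -mE ltnS leqnn => /(_ isT).
  by rewrite -rcons_cons !nth_rcons /= -mE ltnSn ltnn eqxx.
have rz l : l <= m -> r (phi (z (v l))).1.1 = v l.
  rewrite leq_eqVlt => /orP[/eqP ->|lm]; first by have [] := zP _ _ last_edge.
  by have [] := zP _ _ (edges l lm).
have idx l : l <= m -> index (v l) cyc = l.
  by move=> lm; rewrite /v index_uniq // cycE /= ltnS -mE.
pose u l := phi (z (v l)).
have slope_mono l l' : l < l' -> l' <= m -> slope (u l).1.1 < slope (u l').1.1.
  move=> ll' l'm; apply: slope_index; rewrite !rz ?idx //; exact: leq_trans (ltnW ll') l'm.
have link l : l < m -> linked (u l) (u l.+1).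
  by move=> lm; have [] := zP _ _ (edges l lm); rewrite inE.
have [a' a'S close] : exists2 a', a' \in S & forall k,
    (u 0).1.2 k + slope (u m).1.1 * a' k = (u m).1.2 k + slope (u 0).1.1 * a' k.
  have [] := zP _ _ last_edge; rewrite inE => /andP[_ /exists_inP[a' a'S /forallP E]] _.
  by exists a' => // k; apply/eqP/E.
(* The default makes [a] total; only the indices [l < m] matter. *)
pose a l := odflt a' [pick a in S | [forall k,
  (u l.+1).1.2 k + slope (u l).1.1 * a k == (u l).1.2 k + slope (u l.+1).1.1 * a k]].
have aP l : l < m -> a l \in S /\ forall k,
    (u l.+1).1.2 k + slope (u l).1.1 * a l k = (u l).1.2 k + slope (u l.+1).1.1 * a l k.
  move=> /link /andP[_ /exists_inP[a1 a1S E1]]; rewrite /a; case: pickP => [a2 /andP[a2S /forallP E2]|/(_ a1)].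
    by split=> // k; apply/eqP/E2.
  by rewrite a1S E1.
have S_rho a1 : a1 \in S -> (\sum_k ((a1 k : nat)%:Z) ^+ 2 = rho%:Z)%R.
  move=> /S_sphere <-; rewrite -[RHS]natz natr_sum; apply: eq_bigr => k _.
  by rewrite natrX natz.
have rearrange (i j p' q : int) : (i + p' = j + q -> i - j = q - p')%R by lia.
have eq_a k : ((a 0 k : nat)%:Z = (a' k : nat)%:Z)%R.
  apply: (@sphere_rigidity t m (fun l k => Posz ((u l).1.2 k)) (fun l => Posz (slope (u l).1.1))
    (fun l k => Posz (a l k)) (fun k => Posz (a' k)) (Posz rho)) => [l lm|l k' lm|k'|l lm||].
  - by rewrite ltz_nat slope_mono.
  - have [_ /(_ k')] := aP l lm; move=> /(congr1 Posz); rewrite !PoszD !PoszM => E.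
    by rewrite mulrBl; exact: rearrange E.
  - move: (close k') => /(congr1 Posz); rewrite !PoszD !PoszM => E.
    by rewrite mulrBl; exact: rearrange (esym E).
  - by apply: S_rho; have [] := aP l lm.
  - exact: S_rho.
  - exact: ltnW.
have z_neq l l' : l < l' -> l' <= m -> z (v l') != z (v l).
  move=> ll' l'm; apply: contraTneq (slope_mono _ _ ll' l'm) => E.
  by rewrite /u E ltnn.
exists (z (v 0)), (z (v 1)), (z (v m)); split.
- by apply: z_neq => //; lia.
- exact: z_neq.
rewrite -/(u 0) -/(u 1) -/(u m); apply/andP; split.
  have := slope_mono 0 1 isT (ltnW m_gt1).
  by apply: contraTneq => ->; rewrite ltnn.
apply/forallP => k; have [_ /(_ k)] := aP 0 (ltnW m_gt1); have := close k.
move=> /(congr1 Posz) + /(congr1 Posz); rewrite !PoszD !PoszM eq_a.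
set c0 := Posz (slope (u 0).1.1); set c1 := Posz (slope (u 1).1.1); set cm := Posz (slope (u m).1.1).
move=> E1 E2; apply/eqP.
have -> : (Posz ((u m).1.2 k) - Posz ((u 0).1.2 k) = (cm - c0) * Posz (a' k))%R.
  by rewrite mulrBl; exact: rearrange (esym E1).
have -> : (Posz ((u 1).1.2 k) - Posz ((u 0).1.2 k) = (c1 - c0) * Posz (a' k))%R.
  by rewrite mulrBl; exact: rearrange E2.
by rewrite mulrCA.
Qed.

(** The grid point of [phi z] is determined by [phi x], [phi y] and the part of [phi z], because
    distinct parts have distinct slopes. Replacing it by an arbitrary grid point is therefore
    injective. *)
Lemma card_collinear (x y z : 'I_h) : z != x -> z != y ->
  #|[set phi : {ffun 'I_h -> vertex} | collinear (phi x) (phi y) (phi z)]|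
    * (dilation * b) ^ t <= #|{: vertex}| ^ h.
Proof.
move=> zx zy; set C := [set phi | _].
pose g (q : {ffun 'I_h -> vertex} * {ffun 'I_t -> 'I_(dilation * b)}) : {ffun 'I_h -> vertex} :=
  upd q.1 z ((q.1 z).1.1, q.2, (q.1 z).2).
have g_inj : {in setX C setT &, injective g}.
  move=> [phi y1] [phi' y1']; rewrite !inE !andbT /= => /andP[uv /forallP col] /andP[_ /forallP col'] E.
  have Ek (i : 'I_h) : i != z -> phi i = phi' i.
    by move=> wz; have /ffunP/(_ i) := E; rewrite !upd_neq.
  have := congr1 (fun f : {ffun 'I_h -> vertex} => f z) E; rewrite !upd_eq => -[pz -> ez].
  congr pair; apply/ffunP => w; have [->|/Ek //] := eqVneq w z.
  have Ex : phi x = phi' x by rewrite Ek // eq_sym.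
  have Ey : phi y = phi' y by rewrite Ek // eq_sym.
  rewrite [phi z]surjective_pairing [phi' z]surjective_pairing.
  rewrite [(phi z).1]surjective_pairing [(phi' z).1]surjective_pairing pz ez.
  congr (_, _, _); apply/ffunP => k; apply: val_inj; apply/eqP; rewrite -eqz_nat /=.
  have := eqP (col' k); rewrite -Ex -Ey -pz -(eqP (col k)) => /eqP.
  rewrite -subr_eq0 -mulrBr mulf_eq0 subr_eq0 => /orP[|].
    by move=> /eqP[/slope_inj yx]; rewrite yx eqxx in uv.
  by rewrite opprB addrA subrK subr_eq0 eq_sym.
have cT : #|[set: {ffun 'I_t -> 'I_(dilation * b)}]| = (dilation * b) ^ t.
  by rewrite cardsT card_ffun !card_ord.
rewrite -cT -cardsX -(card_in_imset g_inj).
by apply: leq_trans (max_card _) _; rewrite card_ffun card_ord.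
Qed.

Lemma card_homs_host :
  #|homs H host| * (dilation * b) ^ t <= h ^ 3 * #|{: vertex}| ^ h.
Proof.
pose C (q : 'I_h * 'I_h * 'I_h) := if (q.2 != q.1.1) && (q.2 != q.1.2) then
  [set phi : {ffun 'I_h -> vertex} | collinear (phi q.1.1) (phi q.1.2) (phi q.2)] else set0.
have sub : homs H host \subset \bigcup_q C q.
  apply/subsetP => phi /homs_collinear[x [y [z [zx zy col]]]].
  by apply/bigcupP; exists (x, y, z); rewrite // /C /= zx zy inE.
apply: leq_trans (leq_mul (leq_trans (subset_leq_card sub) (card_bigcup_le _)) (leqnn _)) _.
rewrite big_distrl /=; apply: (@leq_trans (\sum_(q : 'I_h * 'I_h * 'I_h) #|{: vertex}| ^ h)).
  apply: leq_sum => q _; rewrite /C; case: ifP => [/andP[zx zy]|_]; last by rewrite cards0.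
  exact: card_collinear.
by rewrite sum_nat_const !card_prod card_ord -[h * h * h]mulnA.
Qed.

(** Each base point [x], direction [a] in [S] and pair of extra coordinates span a copy of [H], in
    which [T'] must reverse an edge. Two points in different parts determine all these data, so the
    reversed edges are distinct. *)
Lemma host_far (T' : rel vertex) :
  (forall phi : {ffun 'I_h -> vertex}, phi \in homs H T' -> ~~ injectiveb phi) ->
  b ^ t * #|S| * N ^ 2 <= #|[set p : vertex * vertex | host p.1 p.2 && ~~ T' p.1 p.2]|.
Proof.
move=> free.
pose X := ({ffun 'I_t -> 'I_b} * {ffun 'I_t -> 'I_b} * ('I_N * 'I_N))%type.
have bound (i : 'I_h) (n x a : nat) : x < n -> a < n -> x + slope i * a < dilation * n.
  by move=> xn an; have := slope_lt i; rewrite /dilation; nia.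
pose psi (q : X) : {ffun 'I_h -> vertex} := [ffun i =>
  (i, [ffun k => Ordinal (bound i _ _ _ (ltn_ord (q.1.1 k)) (ltn_ord (q.1.2 k)))],
   Ordinal (bound i _ _ _ (ltn_ord q.2.1) (ltn_ord q.2.2)))].
have psi_linked q x y : q.1.2 \in S -> (x, y) \in B -> linked (psi q x) (psi q y).
  move=> qS xy; rewrite /linked !ffunE xy /=; apply/exists_inP; exists q.1.2 => //.
  by apply/forallP => k; rewrite !ffunE /=; apply/eqP; lia.
have psi_host q x y : q.1.2 \in S -> H x y -> host (psi q x) (psi q y).
  move=> qS Hxy; rewrite /host; have p1 z : (psi q z).1.1 = z by rewrite ffunE.
  rewrite !p1 Hxy andbT (negbTE (Hanti Hxy)) andbF; case: ifP => // nl.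
  have nB : (x, y) \notin B by apply: contraFN nl; exact: psi_linked.
  have := keyP Hxy nB; rewrite /position !p1.
  have := ltn_ord (enum_rank (psi q x)); have := ltn_ord (enum_rank (psi q y)).
  by set n := #|_|; move=> *; nia.
have broken q : exists e : 'I_h * 'I_h, (q.1.2 \in S) ==>
    [&& H e.1 e.2, host (psi q e.1) (psi q e.2) & ~~ T' (psi q e.1) (psi q e.2)].
  have [qS|nS] := boolP (q.1.2 \in S); last first.
    by case: {+}cyc cyc_size => // i c _; exists (i, i).
  have psi_inj : injectiveb (psi q) by apply/injectiveP => x y; rewrite !ffunE => -[].
  have : psi q \notin homs H T' by apply/negP => /free; rewrite psi_inj.
  rewrite inE => /forallPn[x /forallPn[y]]; rewrite negb_imply => /andP[Hxy nT].
  by exists (x, y); rewrite /= Hxy nT psi_host.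
have {broken} /fin_all_exists[f fP] := broken.
pose Q := [set q : X | q.1.2 \in S].
pose g q := (psi q (f q).1, psi q (f q).2).
have g_inj : {in Q &, injective g}.
  move=> q q'; rewrite !inE => qS q'S [].
  have := fP q; rewrite qS => /andP[Hq _].
  have f12 : (f q).1 != (f q).2 by apply: contraTneq Hq => ->; rewrite (negbTE (Hirr _)).
  rewrite !ffunE => -[E1 F1 G1] [E2 F2 G2].
  have s12 : slope (f q).1 != slope (f q).2 by rewrite (inj_eq slope_inj).
  have solve n (x a x' a' : 'I_n) : x + slope (f q).1 * a = x' + slope (f q).1 * a' ->
      x + slope (f q).2 * a = x' + slope (f q).2 * a' -> x = x' /\ a = a'.
    move=> e1 e2; have aa : (a : nat) = a' by move: s12 e1 e2; nia.
    by split; apply: val_inj => //=; move: e1; rewrite aa; lia.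
  rewrite -E1 -E2 in F1 F2 G1 G2.
  have vecs k : q.1.1 k = q'.1.1 k /\ q.1.2 k = q'.1.2 k.
    apply: solve.
      by have /ffunP/(_ k)/(congr1 val) := F1; rewrite !ffunE.
    by have /ffunP/(_ k)/(congr1 val) := F2; rewrite !ffunE.
  have [ext1 ext2] := solve _ _ _ _ _ G1 G2.
  rewrite [q]surjective_pairing [q']surjective_pairing.
  rewrite [q.1]surjective_pairing [q'.1]surjective_pairing.
  rewrite [q.2]surjective_pairing [q'.2]surjective_pairing ext1 ext2.
  by congr (_, _, _); apply/ffunP => k; have [] := vecs k.
have -> : b ^ t * #|S| * N ^ 2 = #|Q|.
  have -> : Q = setX (setX setT S) setT by apply/setP => q; rewrite !inE andbT.
  by rewrite !cardsX !cardsT card_prod card_ffun !card_ord mulnn.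
rewrite -(card_in_imset g_inj); apply: subset_leq_card; apply/subsetP => _ /imsetP[q qQ ->].
by rewrite inE in qQ; have := fP q; rewrite qQ !inE => /and3P[_ -> ->].
Qed.

End Construction.

(** * Copies *)

Lemma homs_embedding (h n : nat) (H : rel 'I_h) (T : rel 'I_n) phi :
  embedding H T phi = (phi \in homs H T) && injectiveb phi.
Proof. by rewrite /embedding andbC inE. Qed.

(** Embeddings with the same copy map into the same set of at most [h] vertices. *)
Lemma card_embeddings_le (h n : nat) (H : rel 'I_h) (T : rel 'I_n) :
  #|[set phi | embedding H T phi]| <= h ^ h * num_copies H T.
Proof.
rewrite /num_copies; set E := [set phi | _].
rewrite -sum1_card (partition_big_imset (copy_of H)) /= mulnC -sum_nat_const.
apply: leq_sum => c /imsetP[phi0 phi0E ->].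
rewrite sum1_card.
apply: (@leq_trans #|ffun_on_mem 'I_h (mem (copy_of H phi0).1)|).
  apply: subset_leq_card; apply/subsetP => phi; rewrite inE => /andP[_ /eqP[imE _]].
  by apply/ffun_onP => a; rewrite /= -imE; apply: imset_f; exact: mem_set.
rewrite card_ffun_on card_ord.
have le : #|(copy_of H phi0).1| <= h.
  by apply: leq_trans (leq_imset_card _ _) _; rewrite -[leqRHS]card_ord max_card.
by have [h0|h_gt0] := posnP h; [rewrite {2 4}h0|rewrite leq_exp2r].
Qed.

Lemma num_copies_le_embeddings (h n : nat) (H : rel 'I_h) (T : rel 'I_n) :
  num_copies H T <= #|[set phi | embedding H T phi]|.
Proof. exact: leq_imset_card. Qed.

Lemma H_freeP (h n : nat) (H : rel 'I_h) (T : rel 'I_n) :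
  H_free H T <-> forall phi, ~~ embedding H T phi.
Proof.
split=> [free phi|none].
  apply/negP => phiE; have : 0 < num_copies H T.
    by apply/card_gt0P; exists (copy_of H phi); rewrite imset_f // inE.
  by rewrite free.
apply/eqP; rewrite -leqn0; apply: leq_trans (num_copies_le_embeddings _ _) _.
by rewrite leqn0 cards_eq0; apply/eqP/setP => phi; rewrite !inE (negbTE (none phi)).
Qed.

(** Edges between the sides are dropped, so a cycle would stay on one side. The number of ancestors
    then orders both sides at once. *)
Lemma acyclic_order (h : nat) (H : rel 'I_h) (A : {set 'I_h}) :
  acyclic_on H A -> acyclic_on H (~: A) ->
  exists2 kappa : 'I_h -> 'I_h, injective kappa &
    forall x y, H x y -> (x \in A) = (y \in A) -> kappa x < kappa y.
Proof.
move=> acA acC.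
pose e x y := H x y && ((x \in A) == (y \in A)).
have acyclic x y : e x y -> ~~ connect e y x.
  move=> exy; apply/connectP => -[p].
  case/shortenP => q qpath quniq _ xq.
  have cyc : cycle e (y :: q) by rewrite /= rcons_path qpath -xq.
  have cycH : cycle H (y :: q).
    by move: cyc; apply: sub_cycle => a b /andP[].
  have side : all (fun z => (z \in A) == (y \in A)) (y :: q).
    have sideP a r : path e a r -> all (fun z => (z \in A) == (a \in A)) r.
      by elim: r a => //= b r IH a /andP[/andP[_ /eqP ->] /IH ->]; rewrite eqxx.
    by rewrite /= eqxx sideP.
  have [yA|yA] := boolP (y \in A).
    have := acA (y :: q) isT quniq; rewrite cycH; move=> /(_ _)/negP; apply=> //.
    by apply: sub_all side => z /eqP ->.
  have := acC (y :: q) isT quniq; rewrite cycH; move=> /(_ _)/negP; apply=> //.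
  by apply: sub_all side => z /eqP; rewrite inE => ->.
pose anc x := #|[set z | connect e z x]|.
have anc_lt x y : e x y -> anc x < anc y.
  move=> exy; apply: proper_card; apply/properP; split.
    by apply/subsetP => z; rewrite !inE => /connect_trans; apply; apply: connect1.
  by exists y; rewrite !inE ?connect0 // acyclic.
have [kappa kinj kmono] := rank_of_key anc; exists kappa => // x y Hxy xyA.
by apply/kmono/anc_lt; rewrite /e Hxy xyA eqxx.
Qed.

(** Passing from homomorphisms to copies costs a factor 2 for injectivity and [h ^ h] for
    repetitions; both are absorbed in [e ^ (1 + h)]. *)
Lemma poly_many_copies (h : nat) (H : rel 'I_h) (A : {set 'I_h}) :
  oriented_graph H -> acyclic_on H A -> acyclic_on H (~: A) ->
  exists C e0, forall e, e0 <= e -> exists N, forall n, N <= n -> forall T : rel 'I_n,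
    tournament T ->
    (forall T', tournament T' -> H_free H T' -> 22 * n ^ 2 <= e * tdist T T') ->
    n ^ h <= e ^ C * num_copies H T.
Proof.
move=> [Hirr Hanti] acA acC; have [kappa kinj kmono] := acyclic_order acA acC.
have [C [e0 many]] := poly_many_homs Hanti kinj kmono.
exists (C + 1 + h), (2 + h + e0) => e e_big.
have [|N manyN] := many e; first by lia.
have e_gt0 : 0 < e by lia.
exists (N + 2 * e ^ C * h ^ 2 + 1) => n n_big T [Tirr Tt] Tfar.
have [n1 n2 n3] : [/\ N <= n, 2 * e ^ C * h ^ 2 <= n & 0 < n].
  by move: n_big; move: (2 * _ * _); clear => a b; split; lia.
have {}manyN : n ^ h <= e ^ C * #|homs H T|.
  apply: manyN => // [u w /Tt|T' T'irr T't none]; first by case: (T u w); case: (T w u).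
  apply: Tfar => //; apply/H_freeP => phi; rewrite homs_embedding.
  by apply/negP => /andP[/none/negP].
have := @card_injective_part 'I_h 'I_n (homs H T) (e ^ C).
rewrite !card_ord => /(_ n3 manyN n2) le; apply: leq_trans le _.
have emb : #|[set z in homs H T | injectiveb z]| <= h ^ h * num_copies H T.
  apply: leq_trans (card_embeddings_le H T); apply: eq_leq; apply: eq_card => phi.
  by rewrite [LHS]inE [RHS]inE homs_embedding.
apply: leq_trans (leq_mul (leqnn _) emb) _; rewrite mulnA leq_mul2r; apply/orP; right.
rewrite !expnD expn1 leq_mul //; first by rewrite mulnC leq_mul2l; apply/orP; right; lia.
by have [->//|h_gt0] := posnP h; rewrite leq_exp2r //; lia.
Qed.

Lemma acyclic_on_increasing (h : nat) (H : rel 'I_h) (A : {set 'I_h}) (key : 'I_h -> nat) :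
  (forall x y, x \in A -> y \in A -> H x y -> key x < key y) -> acyclic_on H A.
Proof.
move=> incr [|x p] // _ _ /allP cA; apply/negP => cyc.
have : path (fun x y => key x < key y) x (rcons p x).
  have sub : {in mem A &, subrel H (fun x y => key x < key y)} by move=> y z; exact: incr.
  apply: (sub_in_path sub) cyc.
  apply/allP => y; rewrite in_cons mem_rcons => /orP[/eqP ->|/cA //].
  by apply: (cA x); rewrite mem_head.
move=> /(order_path_min (fun y x z => @ltn_trans (key y) (key x) (key z)))/allP/(_ x).
by rewrite mem_rcons inE eqxx ltnn => /(_ isT).
Qed.

(** Along the edges of [H] outside [B] the key increases, so a proper 2-colouring of [B] would have
    acyclic colour classes. *)
Lemma feedback_not_bipartite (h : nat) (H : rel 'I_h) (B : {set 'I_h * 'I_h}) :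
  (forall A, acyclic_on H A -> ~ acyclic_on H (~: A)) -> feedback H B ->
  forall f : 'I_h -> bool, exists x y, (x, y) \in B /\ f x = f y.
Proof.
move=> nopart /feedbackP[_ _ [key keyP]] f.
have [/existsP[x /existsP[y /andP[xy /eqP fxy]]]|] :=
  boolP [exists x, [exists y, ((x, y) \in B) && (f x == f y)]]; first by exists x, y.
rewrite negb_exists => /forallP proper_f.
have incr x y : f x = f y -> H x y -> key x < key y.
  move=> fxy Hxy; apply: keyP => //; apply/negP => xy.
  by have := proper_f x; rewrite negb_exists => /forallP/(_ y); rewrite xy fxy eqxx.
case: (nopart [set x | f x]); apply: (@acyclic_on_increasing _ _ _ key) => x y;
  rewrite !inE => fx fy; apply: incr; first by rewrite fx fy.
by rewrite (negbTE fx) (negbTE fy).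
Qed.

Lemma ex_sparse_far_tournaments (h : nat) (H : rel 'I_h) :
  oriented_graph H -> (forall A, acyclic_on H A -> ~ acyclic_on H (~: A)) ->
  exists2 D, 0 < D & forall t b N, 0 < b ->
  exists2 n, n = h * (D * b) ^ t * (D * N) & exists2 T : rel 'I_n, tournament T &
    (forall T', H_free H T' -> b ^ (2 * t) * N ^ 2 <= (t * b ^ 2).+1 * tdist T T') /\
    num_copies H T * (D * b) ^ t <= h ^ 3 * n ^ h.
Proof.
move=> [Hirr Hanti] nopart.
have [B Bf Bmin] := ex_minimal_feedback Hirr.
have [r [rP rigid]] := ex_rigid_retract Bmin.
have [B_sym B_irr [key keyP]] := feedbackP _ _ Bf.
pose edge v w := (v, w) \in induced_edges B (r @: [set: 'I_h]%SET).
have edge_sym : symmetric edge.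
  by move=> v w; rewrite /edge !inE /= [(w \in _) && _]andbC; congr (_ && _); apply/idP/idP => /B_sym.
have [|f|cyc [cyc_uniq cyc_size cyc_cycle]] := ex_cycle_of_not_bipartite edge_sym.
  by move=> v; rewrite /edge inE (negbTE (B_irr v)).
  (* A colouring of the image of [r] is pulled back to [B] along [r]. *)
  have [x [y [xy fxy]]] := feedback_not_bipartite nopart Bf (f \o r).
  exists (r x), (r y); split=> //; rewrite /edge inE /= !imset_f ?inE // andbT.
  by rewrite andbT; exact: (graph_homP _ _ _ rP).
exists (dilation h) => // t b N b_gt0.
have [rho [S [S_sphere cS]]] := ex_large_sphere t b_gt0.
pose W : finType := ('I_h * {ffun 'I_t -> 'I_(dilation h * b)} * 'I_(dilation h * N))%type.
pose T0 : rel W := host H B key r cyc (N := N) S.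
exists #|W|.
  by rewrite /W !card_prod card_ffun !card_ord.
exists (fun u v => T0 (enum_val u) (enum_val v)).
  split=> [u|u v uv]; first exact: host_irr.
  have -> : T0 (enum_val u) (enum_val v) = ~~ T0 (enum_val v) (enum_val u).
    apply: host_total => //.
    by apply: contraNneq uv => /enum_val_inj ->.
  by case: (T0 _ _).
split=> [T' /H_freeP free|].
  pose T1 : rel W := fun u v => T' (enum_rank u) (enum_rank v).
  have free1 phi : phi \in homs H T1 -> ~~ injectiveb phi.
    move=> phiH; apply/negP => /injectiveP phi_inj.
    have := free [ffun a => enum_rank (phi a)]; rewrite homs_embedding => /negP[].
    apply/andP; split; last first.
      by apply/injectiveP => x y; rewrite !ffunE => /enum_rank_inj/phi_inj.
    move: phiH; rewrite !inE => /forallP phiH; apply/forallP => x; apply/forallP => y.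
    by have /forallP/(_ y) := phiH x; rewrite !ffunE.
  have := host_far Hirr Hanti keyP cyc_uniq cyc_size cyc_cycle S free1.
  set E := [set p | _] => far.
  have le : #|E| <= tdist (fun u v => T0 (enum_val u) (enum_val v)) T'.
    pose rk (p : W * W) := (enum_rank p.1, enum_rank p.2).
    have rk_inj : injective rk by move=> [u v] [u' v'] [/enum_rank_inj -> /enum_rank_inj ->].
    rewrite -(card_imset _ rk_inj); apply: subset_leq_card; apply/subsetP => _ /imsetP[[u v] + ->].
    by rewrite !inE /= !enum_rankK.
  apply: leq_trans (leq_mul (leqnn _) (leq_trans far le)).
  rewrite mul2n -addnn expnD mulnA mulnA leq_mul2r; apply/orP; right.
  by rewrite mulnAC leq_mul2r cS orbT.
apply: leq_trans _ (card_homs_host key B_sym B_irr rigid cyc_uniq cyc_size cyc_cycle N S_sphere).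
rewrite leq_mul2r; apply/orP; right; apply: leq_trans (num_copies_le_embeddings _ _) _.
pose vl (phi : {ffun 'I_h -> 'I_#|W|}) : {ffun 'I_h -> W} := [ffun a => enum_val (phi a)].
have vl_inj : injective vl.
  by move=> phi phi' E; apply/ffunP => a; have /ffunP/(_ a) := E; rewrite !ffunE => /enum_val_inj.
rewrite -(card_imset _ vl_inj); apply: subset_leq_card; apply/subsetP => _ /imsetP[phi + ->].
rewrite inE homs_embedding => /andP[+ _]; rewrite !inE => /forallP phiH.
apply/forallP => x; apply/forallP => y; have /forallP/(_ y) := phiH x.
by rewrite !ffunE.
Qed.

(** * Easy and hard oriented graphs *)

Local Open Scope ring_scope.

Lemma easy_of_acyclic_partition (R : realType) (h : nat) (H : rel 'I_h) (A : {set 'I_h}) :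
  oriented_graph H -> acyclic_on H A -> acyclic_on H (~: A) -> easy R H.
Proof.
move=> oH acA acC; have [C [e0 many]] := poly_many_copies oH acA acC.
(* For an integer [e] between [22 / eps] and [23 / eps], one has [eps ^ 2 * e <= 23 * eps <= 1];
   this explains the exponent [2 * C]. The bound on [eps] also ensures [e0 <= e]. *)
exists (2 * C)%N%:R, (23 + e0)%N%:R^-1; split; first by rewrite invr_gt0 ltr0n.
move=> eps eps_gt0 eps_lt.
have eps_inv : (23 + e0)%N%:R < eps^-1 by rewrite -[ltLHS]invrK ltf_pV2 // posrE invr_gt0 ltr0n.
pose e := (Num.truncn (22 / eps)).+1.
have eps22 : 0 <= 22 / eps by rewrite divr_ge0 // ltW.
have e_gt : 22 / eps < e%:R by exact: truncnS_gt.
have e_lt : e%:R <= 23 / eps.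
  have -> : e%:R = (Num.truncn (22 / eps))%:R + 1 :> R by rewrite natr1.
  rewrite (_ : 23 / eps = 22 / eps + eps^-1); last first.
    by rewrite -(natr1 22) mulrDl mul1r.
  apply: lerD; first by rewrite truncn_le.
  by apply: le_trans (ltW eps_inv); rewrite ler1n.
have e0_le : (e0 <= e)%N.
  rewrite -(ler_nat R); apply: le_trans (ltW e_gt).
  apply: le_trans (_ : (23 + e0)%N%:R <= _); first by rewrite ler_nat leq_addl.
  by apply: le_trans (ltW eps_inv) _; rewrite ler_peMl ?invr_ge0 ?(ltW eps_gt0) // ler1n.
have [N manyN] := many e e0_le.
apply: ereal_sup_ubound; exists (eps `^ (2 * C)%N%:R) => //=.
exists N => n Nn T Tt Tfar.
have le : (n ^ h <= e ^ C * num_copies H T)%N.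
  apply: manyN => // T' T't free; rewrite -(ler_nat R) natrM natrX natrM.
  have eps_neq0 : eps != 0 by rewrite gt_eqF.
  apply: (@le_trans _ _ (22 / eps * (tdist T T')%:R)); last by rewrite ler_wpM2r // ltW.
  by rewrite -{1}(divfK eps_neq0 22) -[leLHS]mulrA ler_pM2l ?divr_gt0 // Tfar.
rewrite powR_mulrn ?(ltW eps_gt0) // exprM expr2.
move: le; rewrite -(ler_nat R) natrX natrM natrX => le.
apply: (@le_trans _ _ ((eps * eps) ^+ C * (e%:R ^+ C * (num_copies H T)%:R))).
  by rewrite ler_wpM2l // exprn_ge0 // mulr_ge0 // ltW.
rewrite mulrA -exprMn ler_piMl // exprn_ile1 //; first by rewrite !mulr_ge0 // ltW.
apply: (@le_trans _ _ (eps * eps * (23 / eps))).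
  by rewrite ler_wpM2l // mulr_ge0 // ltW.
rewrite mulrCA mulfK ?gt_eqF // mulrC.
have : eps <= 23^-1.
  apply: le_trans (ltW eps_lt) _; rewrite lef_pV2 ?posrE ?ltr0n // ler_nat.
  by rewrite leq_addr.
by rewrite -(ler_pM2r (x := 23)) // mulVf.
Qed.

(** The dimension [t] is free: for fixed [t] the distance is of order [b ^ -2], while the density of
    copies falls like [b ^ -t], so every power of the distance is eventually beaten. *)
Lemma fstar_small (R : realType) (h : nat) (H : rel 'I_h) :
  oriented_graph H -> (forall A, acyclic_on H A -> ~ acyclic_on H (~: A)) ->
  forall t, exists2 k : nat, (0 < k)%N & forall b, (0 < b)%N ->
    (fstar H ((k * b ^ 2)%N%:R^-1 : R) <= ((h ^ 3)%N%:R / (b ^ t)%N%:R)%:E)%E.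
Proof.
move=> oH nopart t; have [D D_gt0 ex] := ex_sparse_far_tournaments oH nopart.
have h_gt0 : (0 < h)%N.
  rewrite lt0n; apply/eqP => h0; apply: (nopart finset.set0) => -[|x c] // _ _ _;
    by have := ltn_ord x; rewrite {2}h0.
(* The factor [t.+1] comes from [t * b ^ 2 + 1 <= t.+1 * b ^ 2], the other one from the square of
   the number of vertices. *)
exists (t.+1 * (h ^ 2 * D ^ (2 * t + 2)))%N; first by rewrite !muln_gt0 !expn_gt0 h_gt0 D_gt0.
set k := (t.+1 * _)%N; move=> b b_gt0.
apply: ge_ereal_sup => _ [f [N0 fP] <-]; rewrite lee_fin.
have [n nE [T tT [far few]]] := ex t b N0.+1 b_gt0.
have bt_gt0 : (0 < b ^ t)%N by rewrite expn_gt0 b_gt0.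
have Db_gt0 : (0 < (D * b) ^ t)%N by rewrite expn_gt0 muln_gt0 D_gt0 b_gt0.
have n_big : (N0 < n)%N by rewrite nE; nia.
have n_gt0 : (0 < n)%N := leq_ltn_trans (leq0n _) n_big.
have kb_gt0 : (0 < k * b ^ 2)%N by rewrite !muln_gt0 !expn_gt0 h_gt0 D_gt0 b_gt0.
have Tfar : eps_far H T ((k * b ^ 2)%N%:R^-1 : R).
  move=> T' tT' free; rewrite mulrC ler_pdivrMr ?ltr0n // -natrX -natrM ler_nat.
  have bound : (b ^ (2 * t) * N0.+1 ^ 2 <= t.+1 * b ^ 2 * tdist T T')%N.
    apply: leq_trans (far T' free) _; rewrite leq_mul2r; apply/orP; right.
    by rewrite mulSn addnC -addn1 leq_add2l expn_gt0 b_gt0.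
  have -> : (n ^ 2 = h ^ 2 * D ^ (2 * t + 2) * (b ^ (2 * t) * N0.+1 ^ 2))%N.
    rewrite nE !expnMn expnD -!expnM [(t * 2)%N]mulnC; lia.
  apply: leq_trans (leq_mul (leqnn _) bound) _; rewrite /k; lia.
have := fP n (ltnW n_big) T tT Tfar => fle.
have few' : (num_copies H T * b ^ t <= h ^ 3 * n ^ h)%N.
  apply: leq_trans few; rewrite leq_mul2l expnMn leq_pmull ?orbT //.
  by rewrite expn_gt0 D_gt0.
rewrite ler_pdivlMr ?ltr0n // -(ler_pM2r (x := n%:R ^+ h)) ?exprn_gt0 ?ltr0n //.
rewrite mulrAC -natrX -natrM.
apply: le_trans (_ : (num_copies H T)%:R * (b ^ t)%N%:R <= _).
  by rewrite ler_pM2r ?ltr0n // natrX.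
by rewrite -natrM ler_nat.
Qed.

Lemma acyclic_partition_of_easy (R : realType) (h : nat) (H : rel 'I_h) :
  oriented_graph H -> easy R H ->
  exists A : {set 'I_h}, acyclic_on H A /\ acyclic_on H (~: A).
Proof.
move=> oH [c [eps0 [eps0_gt0 easyH]]].
apply: contrapT => nopart'.
have nopart A : acyclic_on H A -> ~ acyclic_on H (~: A).
  by move=> acA acC; apply: nopart'; exists A.
pose C := (Num.truncn `|c|).+1.
have cC : c <= C%:R by apply: le_trans (ler_norm c) (ltW _); exact: truncnS_gt.
(* In dimension [2 * C + 1] the bound [h ^ 3 / b ^ (2 * C + 1)] is below
   [eps ^ C = 1 / (k ^ C * b ^ (2 * C))] as soon as [b > h ^ 3 * k ^ C]. *)
have [k k_gt0 kP] := fstar_small R oH nopart (2 * C).+1.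
pose b := (h ^ 3 * k ^ C + Num.truncn eps0^-1).+1.
have b_big : (h ^ 3 * k ^ C < b)%N by rewrite ltnS leq_addr.
have b_eps : eps0^-1 < b%:R.
  apply: lt_le_trans (truncnS_gt _) _.
  by rewrite ler_nat ltnS leq_addl.
set eps : R := (k * b ^ 2)%N%:R^-1.
have kb_gt0 : (0 < k * b ^ 2)%N by rewrite muln_gt0 k_gt0 expn_gt0.
have eps_gt0 : 0 < eps by rewrite invr_gt0 ltr0n.
have eps_lt : eps < eps0.
  rewrite -[ltRHS]invrK ltf_pV2 ?posrE ?ltr0n ?invr_gt0 //.
  apply: lt_le_trans b_eps _; rewrite ler_nat; nia.
have eps_le1 : eps <= 1 by rewrite invf_le1 ?ltr0n // ler1n.
have := le_trans (easyH eps eps_gt0 eps_lt) (kP b isT); rewrite lee_fin.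
apply/negP; rewrite -ltNge.
apply: (@lt_le_trans _ _ (eps ^+ C)); last first.
  by rewrite -powR_mulrn ?(ltW eps_gt0) // ger_powR // eps_gt0.
rewrite exprVn -natrX ltr_pdivrMr ?ltr0n ?expn_gt0 // mulrC.
rewrite ltr_pdivlMr ?ltr0n ?expn_gt0 ?kb_gt0 // -natrM ltr_nat.
rewrite expnMn -expnM expnS mulnA ltn_pmul2r //.
by rewrite expn_gt0.
Qed.

Theorem theorem1p1 (R : realType) (h : nat) (H : rel 'I_h) :
  oriented_graph H ->
  (easy R H <->
   exists A : {set 'I_h}, acyclic_on H A /\ acyclic_on H (~: A)).
Proof.
move=> oH; split; first exact: acyclic_partition_of_easy.
by case=> A [acA acC]; exact: easy_of_acyclic_partition acC.
Qed.
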